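(* Let $K \geq 3$, $N \geq 1$ and $d \geq 1$ be integers, and suppose $d_i = d$ and $M_i = N_i = N$ for all $1 \leq i \leq K$. Let $\mathcal H = \prod_{1 \leq i \neq j \leq K} \mathbb{C}^{N \times N}$ be the space of tuples $h = (H_{ij})_{i \neq j}$ of cross-channel matrices. Then for generic $h \in \mathcal H$: if $Kd(2N - (K+1)d) \geq 0$, the variety $\mathcal F(h)$ of feasible strategies is non-empty and has dimension $Kd(2N - (K+1)d)$; and if $Kd(2N-(K+1)d) < 0$, then $\mathcal F(h)$ is empty.
   Context: For $h = (H_{ij})_{i\neq j}$ with $H_{ij} \in \mathbb{C}^{N \times N}$, a feasible strategy is a tuple $(U_1, \ldots, U_K, V_1, \ldots, V_K)$ of $d$-dimensional linear subspaces of $\mathbb{C}^N$ such that $v^T H_{ij} u = 0$ for all $v \in V_i$, $u \in U_j$ and all $i \neq j$. The variety $\mathcal F(h)$ of feasible strategies is the set of such tuples, a closed subvariety of $G(d,N)^{2K}$, where $G(d,N)$ is the Grassmannian of $d$-dimensional subspaces of $\mathbb{C}^N$; its dimension is the maximum dimension of its irreducible components. A statement holds ''for generic $h$'' if it holds for all $h$ in some nonempty Zariski-open (hence dense) subset of $\mathcal H$. *)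

(* Defs.v *)
(* complex numbers C = R[i] for R : realType (any realType is
   isomorphic to the reals), subspaces via mxalgebra row spaces. *)
From HB Require Import structures.
From mathcomp Require Import all_boot all_order all_algebra.
From mathcomp Require Import reals complex.
Set Implicit Arguments. Unset Strict Implicit. Unset Printing Implicit Defensive.
Import Order.TTheory GRing.Theory Num.Theory.
Local Open Scope ring_scope.

Section Defs.
Variable R : realType.
Local Notation C := (R[i]).

Inductive is_poly (T : Type) : ((T -> C) -> C) -> Prop :=
| poly_const (c : C) : is_poly (fun _ => c)
| poly_var (t : T) : is_poly (fun x => x t)
| poly_add p q : is_poly p -> is_poly q -> is_poly (fun x => p x + q x)
| poly_mul p q : is_poly p -> is_poly q -> is_poly (fun x => p x * q x).

Definition zclosed (T : finType) (W : (T -> C) -> Prop) : Prop :=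
  exists S : ((T -> C) -> C) -> Prop,
    (forall p, S p -> is_poly p) /\
    (forall x, W x <-> (forall p, S p -> p x = 0)).

Definition zopen (T : finType) (U : (T -> C) -> Prop) : Prop :=
  zclosed (fun x => ~ U x).

Definition generic (T : finType) (P : (T -> C) -> Prop) : Prop :=
  exists U : (T -> C) -> Prop,
    [/\ zopen U, exists x, U x & forall x, U x -> P x].

(* G(d,N): d-dimensional subspaces of C^N (row vectors), represented by the
   canonical square matrix <<A>> of their row space *)
Definition Grass (d N : nat) :=
  {A : 'M[C]_N | (<<A>>%MS == A) && (\rank A == d)}.

(* points of G(d,N)^{2K}: (U_1..U_K, V_1..V_K) *)
Definition strategy (K d N : nat) := (('I_K -> Grass d N) * ('I_K -> Grass d N))%type.

(* Zariski topology on G(d,N)^{2K}: quotient topology from the Stiefel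
   variety of tuples of full-rank d x N matrices (an open subset of the
   affine space with coordinates stiefel_idx). *)
Definition stiefel_idx (K d N : nat) := (bool * 'I_K * 'I_d * 'I_N)%type.

Definition stmat (K d N : nat) (x : stiefel_idx K d N -> C) (b : bool) (i : 'I_K)
  : 'M[C]_(d, N) := \matrix_(a, c) x (b, i, a, c).

Definition stiefel_rep (K d N : nat) (x : stiefel_idx K d N -> C)
    (s : strategy K d N) : Prop :=
  forall i, (stmat x false i == val (s.1 i))%MS /\ (stmat x true i == val (s.2 i))%MS.

Definition gclosed (K d N : nat) (Z : strategy K d N -> Prop) : Prop :=
  exists W : (stiefel_idx K d N -> C) -> Prop,
    zclosed W /\ forall x s, stiefel_rep x s -> (Z s <-> W x).

Definition irreducible (X : Type) (closed : (X -> Prop) -> Prop) (Y : X -> Prop) :=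
  (exists y, Y y) /\
  forall A B, closed A -> closed B -> (forall y, Y y -> A y \/ B y) ->
    (forall y, Y y -> A y) \/ (forall y, Y y -> B y).

Definition irr_chain (X : Type) (closed : (X -> Prop) -> Prop) (F : X -> Prop)
    (n : nat) : Prop :=
  exists c : nat -> X -> Prop,
    (forall k, (k <= n)%N ->
       [/\ closed (c k), irreducible closed (c k) & forall y, c k y -> F y]) /\
    (forall k, (k < n)%N ->
       (forall y, c k y -> c k.+1 y) /\ exists y, c k.+1 y /\ ~ c k y).

(* F (assumed closed) has dimension n *)
Definition has_dim (X : Type) (closed : (X -> Prop) -> Prop) (F : X -> Prop)
    (n : nat) : Prop :=
  irr_chain closed F n /\ ~ irr_chain closed F n.+1.

Definition offdiag (K : nat) := {p : 'I_K * 'I_K | p.1 != p.2}.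
Definition H_idx (K N : nat) := (offdiag K * 'I_N * 'I_N)%type.

Definition Hmat (K N : nat) (h : H_idx K N -> C) (p : offdiag K) : 'M[C]_N :=
  \matrix_(a, b) h (p, a, b).

Definition feasible (K d N : nat) (h : H_idx K N -> C) (s : strategy K d N) : Prop :=
  forall (p : offdiag K) (u v : 'rV[C]_N),
    (v <= val (s.2 (val p).1))%MS -> (u <= val (s.1 (val p).2))%MS ->
    v *m Hmat h p *m u^T = 0.

End Defs.

(* Main.v *)
Require Import Defs.
From HB Require Import structures.
From mathcomp Require Import all_boot all_order all_algebra all_fingroup.
From mathcomp Require Import reals complex boolp closed_field ring zify.
Set Implicit Arguments. Unset Strict Implicit. Unset Printing Implicit Defensive.
Import Order.TTheory GRing.Theory Num.Theory.
Local Open Scope ring_scope.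

(* The incidence variety of pairs (h, strategy) is, over each affine chart of G(d,N)^{2K} (bases
   [1 | X] up to a permutation of columns), the graph of a polynomial map: solving
   [1 | Y] H [1 | X]^T = 0 for the upper left d x d block of each H_ij shows that it is an affine
   space of dimension dim H + n, where n = Kd(2N - (K+1)d).

   Upper bound: dim H + n + 1 polynomials on this affine space are algebraically dependent, so for
   generic h any n+1 of the chart coordinates are dependent on F(h) (and the chart of F(h) is empty
   if n < 0).  A strict chain c_0 < ... < c_m of irreducible closed sets yields m functions
   independent on c_m, f_k being chosen to vanish on c_(k-1) but not on c_k; a count of monomials
   gives m <= n.

   Lower bound: linearizing at X = Y = 0, the equations become Y_i A_ij + B_ij X_j = T_ij, which for
   suitable 0-1 matrices A and B is solvable for all T as soon as (K-1)d <= 2(N-d).  Adding n linear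
   forms l makes the linearization bijective, so the map (h, x) |-> (h, l(x)) from the incidence
   variety to H x C^n is dominant; by quantifier elimination its image contains a nonempty
   Zariski-open set.  For generic h, l thus maps F(h) onto a set containing a nonempty open subset of
   C^n, and cutting by n successive hyperplanes l_k = const gives a chain of length n. *)

(** * Polynomial functions *)

(** Dimension is defined by chains, so each bound must refute or build chains directly: a count of
    monomials plays the part of transcendence degree, and successive cuts that of the theorem on
    fibre dimension. The upper bound has to treat every chart, as a chain may lie outside any given
    one; the lower bound needs only the chart of the identity permutations, since closures carry its
    chains over to the Grassmannians.

    After division by Kd the condition n >= 0 reads (K-1)d <= 2(N-d): X and Y contain at least as
    many unknowns as there are linearized equations. That this count suffices is where K >= 3
    matters. For K = 2 the problem decouples into single equations v^T H u = 0 with generic H, which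
    force 2d <= N, while n >= 0 only asks for 3d <= 2N. With more users, cyclic symmetry lets A_ij
    and B_ij depend on j - i alone, and for even K the odd block out is shared between two
    differences. *)

Section PolynomialFunctions.
Variable R : realType.
Local Notation C := (R[i]).

Lemma is_poly_ext (T : Type) (p q : (T -> C) -> C) : p =1 q -> is_poly p -> is_poly q.
Proof. by move=> /funext ->. Qed.

Lemma is_poly_opp (T : Type) (p : (T -> C) -> C) : is_poly p -> is_poly (fun x => - p x).
Proof.
by move=> pp; apply: is_poly_ext (poly_mul (poly_const T (-1)) pp) => x; rewrite mulN1r.
Qed.

Lemma is_poly_sub (T : Type) (p q : (T -> C) -> C) :
  is_poly p -> is_poly q -> is_poly (fun x => p x - q x).
Proof. by move=> pp pq; apply: poly_add => //; apply: is_poly_opp. Qed.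

Lemma is_poly_sum (T : Type) (I : Type) (s : seq I) (P : pred I) (F : I -> (T -> C) -> C) :
  (forall i, P i -> is_poly (F i)) -> is_poly (fun x => \sum_(i <- s | P i) F i x).
Proof.
move=> pF; elim: s => [|i s IHs].
  by apply: is_poly_ext (poly_const T 0) => x; rewrite big_nil.
case Pi: (P i); last by apply: is_poly_ext IHs => x; rewrite big_cons Pi.
by apply: is_poly_ext (poly_add (pF i Pi) IHs) => x; rewrite big_cons Pi.
Qed.

Lemma is_poly_prod (T : Type) (I : Type) (s : seq I) (P : pred I) (F : I -> (T -> C) -> C) :
  (forall i, P i -> is_poly (F i)) -> is_poly (fun x => \prod_(i <- s | P i) F i x).
Proof.
move=> pF; elim: s => [|i s IHs].
  by apply: is_poly_ext (poly_const T 1) => x; rewrite big_nil.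
case Pi: (P i); last by apply: is_poly_ext IHs => x; rewrite big_cons Pi.
by apply: is_poly_ext (poly_mul (pF i Pi) IHs) => x; rewrite big_cons Pi.
Qed.

Lemma is_poly_exp (T : Type) (p : (T -> C) -> C) n : is_poly p -> is_poly (fun x => p x ^+ n).
Proof.
move=> pp; elim: n => [|n IHn]; first exact: poly_const.
by apply: is_poly_ext (poly_mul pp IHn) => x; rewrite exprS.
Qed.

Lemma is_poly_comp (T Q : Type) (p : (Q -> C) -> C) (f : Q -> (T -> C) -> C) :
  is_poly p -> (forall i, is_poly (f i)) -> is_poly (fun x => p (fun i => f i x)).
Proof.
move=> pp pf; elim: pp => [c|t|p1 p2 _ IH1 _ IH2|p1 p2 _ IH1 _ IH2].
- exact: poly_const.
- exact: pf.
- exact: poly_add.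
- exact: poly_mul.
Qed.

Lemma is_poly_det (T : Type) n (A : (T -> C) -> 'M[C]_n) :
  (forall i j, is_poly (fun x => A x i j)) -> is_poly (fun x => \det (A x)).
Proof.
move=> pA; apply: is_poly_sum => s _; apply: poly_mul; first exact: poly_const.
by apply: is_poly_prod => i _; apply: pA.
Qed.

Lemma is_poly_mulmx (T : Type) m n p (A : (T -> C) -> 'M[C]_(m, n)) (B : (T -> C) -> 'M[C]_(n, p)) :
  (forall i j, is_poly (fun x => A x i j)) -> (forall i j, is_poly (fun x => B x i j)) ->
  forall i j, is_poly (fun x => (A x *m B x) i j).
Proof.
move=> pA pB i j.
apply: (@is_poly_ext _ (fun x => \sum_k A x i k * B x k j)) => [x|]; first by rewrite mxE.
by apply: is_poly_sum => k _; apply: poly_mul.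
Qed.

Lemma is_poly_curve (T : Type) (p : (T -> C) -> C) (u : T -> {poly C}) :
  is_poly p -> exists P : {poly C}, forall t, p (fun i => (u i).[t]) = P.[t].
Proof.
elim=> [c|i|p1 p2 _ [P1 H1] _ [P2 H2]|p1 p2 _ [P1 H1] _ [P2 H2]].
- by exists c%:P => t; rewrite hornerC.
- by exists (u i).
- by exists (P1 + P2) => t; rewrite hornerD H1 H2.
- by exists (P1 * P2) => t; rewrite hornerM H1 H2.
Qed.

Lemma poly_nonroot (P : {poly C}) : P != 0 -> exists t, P.[t] != 0.
Proof.
move=> P0; pose s := [seq k%:R : C | k <- iota 0 (size P)].
have us : uniq s by rewrite map_inj_uniq ?iota_uniq // => a b /eqP; rewrite eqr_nat => /eqP.
case: (boolP (all (root P) s)) => [rs|/allPn[t _ nt]]; last by exists t.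
by have := max_poly_roots P0 rs us; rewrite size_map size_iota ltnn.
Qed.

(** On the line through [x] and [y] both factors become nonzero polynomials in one variable. *)
Lemma is_poly_mul_neq0 (T : Type) (p q : (T -> C) -> C) :
  is_poly p -> is_poly q -> (exists x, p x != 0) -> (exists x, q x != 0) ->
  exists x, p x * q x != 0.
Proof.
move=> pp pq [x px] [y qy].
pose u i : {poly C} := (x i)%:P + (y i - x i) *: 'X.
have uE t i : (u i).[t] = x i + (y i - x i) * t by rewrite !hornerE.
have u0 : (fun i => (u i).[0]) = x by apply/funext => i; rewrite uE mulr0 addr0.
have u1 : (fun i => (u i).[1]) = y by apply/funext => i; rewrite uE mulr1 addrC subrK.
have [P HP] := is_poly_curve u pp; have [Q HQ] := is_poly_curve u pq.
have [|t] := @poly_nonroot (P * Q).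
  apply: mulf_neq0.
    by apply: contraNneq px => P0; rewrite -u0 HP P0 horner0.
  by apply: contraNneq qy => Q0; rewrite -u1 HQ Q0 horner0.
by rewrite hornerM -HP -HQ => H; exists (fun i => (u i).[t]).
Qed.

Lemma is_poly_prod_neq0 (T I : Type) (s : seq I) (F : I -> (T -> C) -> C) :
  (forall i, is_poly (F i)) -> (forall i, exists x, F i x != 0) ->
  exists x, \prod_(i <- s) F i x != 0.
Proof.
move=> pF nF; elim: s => [|i s IHs].
  by exists (fun=> 0); rewrite big_nil oner_eq0.
have [|x Hx] := is_poly_mul_neq0 (pF i) _ (nF i) IHs; first exact: is_poly_prod.
by exists x; rewrite big_cons.
Qed.

Section Monomials.
Variable T : finType.
Local Notation mon := {ffun T -> nat}.

Definition meval (m : mon) (x : T -> C) : C := \prod_t x t ^+ m t.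

Lemma is_poly_meval m : is_poly (meval m).
Proof. by apply: is_poly_prod => t _; apply: is_poly_exp; apply: poly_var. Qed.

Lemma mevalD (m1 m2 : mon) x : meval [ffun t => (m1 t + m2 t)%N] x = meval m1 x * meval m2 x.
Proof. by rewrite /meval -big_split; apply: eq_bigr => t _; rewrite ffunE exprD. Qed.

Lemma meval0 x : meval [ffun => 0%N] x = 1.
Proof. by rewrite /meval big1 // => t _; rewrite ffunE expr0. Qed.

Lemma meval1 (t : T) x : meval [ffun t' => (t' == t) : nat] x = x t.
Proof.
rewrite /meval (bigD1 t) //= big1 => [|t' /negPf nt]; rewrite ffunE.
  by rewrite eqxx expr1 mulr1.
by rewrite nt expr0.
Qed.

Lemma meval_scale (m : mon) (a : C) x :
  meval m (fun t => a * x t) = a ^+ (\sum_t m t)%N * meval m x.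
Proof.
rewrite /meval; under eq_bigr do rewrite exprMn.
by rewrite big_split /=; congr (_ * _); rewrite prodrXr.
Qed.

Lemma is_poly_terms (p : (T -> C) -> C) :
  is_poly p -> exists s : seq (C * mon), forall x, p x = \sum_(u <- s) u.1 * meval u.2 x.
Proof.
elim=> [c|t|p1 p2 _ [s1 H1] _ [s2 H2]|p1 p2 _ [s1 H1] _ [s2 H2]].
- by exists [:: (c, [ffun => 0%N])] => x; rewrite big_seq1 meval0 mulr1.
- by exists [:: (1, [ffun t' => (t' == t) : nat])] => x; rewrite big_seq1 meval1 mul1r.
- by exists (s1 ++ s2) => x; rewrite big_cat H1 H2.
exists [seq (u.1 * v.1, [ffun t => (u.2 t + v.2 t)%N]) | u : C * mon <- s1, v : C * mon <- s2] => x.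
rewrite big_allpairs_dep H1 H2 mulr_suml; apply: eq_bigr => u _.
by rewrite mulr_sumr; apply: eq_bigr => v _; rewrite /= mevalD mulrACA.
Qed.

Lemma is_poly_expand (p : (T -> C) -> C) :
  is_poly p -> exists s : seq mon, exists c : mon -> C,
    [/\ uniq s, forall m, m \in s -> c m != 0 &
        forall x, p x = \sum_(m <- s) c m * meval m x].
Proof.
move=> /is_poly_terms[s H].
pose c m := \sum_(u <- s | u.2 == m) u.1.
exists [seq m <- undup [seq u.2 | u <- s] | c m != 0], c; split.
- by rewrite filter_uniq ?undup_uniq.
- by move=> m; rewrite mem_filter => /andP[].
move=> x; rewrite big_filter H.
rewrite (eq_bigr (fun m => \sum_(u <- s | u.2 == m) u.1 * meval u.2 x)); last first.
  by move=> m _; rewrite /c mulr_suml; apply: eq_bigr => u /eqP ->.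
under [RHS]eq_bigr => m _.
  rewrite (_ : \sum_(u <- s | u.2 == m) _ = \sum_(u <- s) (if u.2 == m then u.1 * meval u.2 x else 0)); last by rewrite big_mkcond.
  over.
rewrite [RHS](_ : _ = \sum_(m <- undup [seq u.2 | u <- s])
   \sum_(u <- s) (if u.2 == m then u.1 * meval u.2 x else 0)); last first.
  rewrite big_mkcond; apply: eq_bigr => m _; case: eqP => //= cm0.
  rewrite -big_mkcond /= (eq_bigr (fun u => u.1 * meval m x)); last by move=> u /eqP ->.
  by rewrite -mulr_suml -/(c m) cm0 mul0r.
rewrite exchange_big /= big_seq [RHS]big_seq; apply: eq_bigr => u us.
have um : u.2 \in undup [seq u.2 | u <- s] by rewrite mem_undup map_f.
rewrite (bigD1_seq u.2) ?undup_uniq //= eqxx big1 ?addr0 // => m.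
by rewrite eq_sym => /negPf ->.
Qed.

(** Exponents are read as digits in base [D]. The weight is additive and separates monomials with
    exponents below [D], so a relation with small exponents has a unique leading monomial. *)
Definition mweight (D : nat) (m : mon) : nat := (\sum_t m t * D ^ enum_rank t)%N.

Lemma mweightD D (m1 m2 : mon) :
  mweight D [ffun t => (m1 t + m2 t)%N] = (mweight D m1 + mweight D m2)%N.
Proof. by rewrite /mweight -big_split; apply: eq_bigr => t _; rewrite ffunE mulnDl. Qed.

Lemma base_digits_inj (D n : nat) (a b : nat -> nat) :
  (forall i, i < n -> a i < D)%N -> (forall i, i < n -> b i < D)%N ->
  (\sum_(i < n) a i * D ^ i = \sum_(i < n) b i * D ^ i)%N ->
  forall i, (i < n)%N -> a i = b i.
Proof.
elim: n a b => [//|n IHn] a b ha hb.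
rewrite !big_ord_recl /= !expn0 !muln1.
have E (f : nat -> nat) :
    (\sum_(i < n) f (bump 0 i) * D ^ bump 0 i)%N = (D * \sum_(i < n) f i.+1 * D ^ i)%N.
  by rewrite big_distrr /=; apply: eq_bigr => i _; rewrite /bump /= add1n expnS mulnCA.
rewrite !E => H.
have h0 : a 0%N = b 0%N.
  have := congr1 (modn ^~ D) H.
  by rewrite ![(D * _)%N]mulnC ![(_ + _ * D)%N]addnC !modnMDl !modn_small ?ha ?hb.
move: H; rewrite h0 => /addnI /eqP.
have D0 : (0 < D)%N by apply: leq_ltn_trans (ha 0%N _).
rewrite eqn_pmul2l // => /eqP H [|i] // hi.
by apply: (IHn (a \o S) (b \o S)) => // j hj; [apply: ha | apply: hb].
Qed.

Lemma mweight_inj D (m1 m2 : mon) :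
  (forall t, m1 t < D)%N -> (forall t, m2 t < D)%N ->
  mweight D m1 = mweight D m2 -> m1 = m2.
Proof.
move=> h1 h2 H.
pose a (m : mon) i := if insub i is Some k then m (@enum_val T T k) else 0%N.
have aE m (k : 'I_#|T|) : a m k = m (enum_val k) by rewrite /a valK.
have wE m : mweight D m = (\sum_(i < #|T|) a m i * D ^ i)%N.
  rewrite /mweight (reindex (@enum_val T T)) /=; last exact/onW_bij/enum_val_bij.
  by apply: eq_bigr => k _; rewrite aE enum_valK.
have lta (m : mon) : (forall t, m t < D)%N -> forall i, (i < #|T|)%N -> (a m i < D)%N.
  by move=> hm i hi; rewrite (aE m (Ordinal hi)).
apply/ffunP => t; rewrite -[t]enum_rankK -!aE.
by apply: (base_digits_inj (lta _ h1) (lta _ h2)) => //; rewrite -!wE.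
Qed.

(* Kronecker substitution: along x_t = z ^ (D ^ rank t) the monomial m becomes
   z ^ mweight D m, and distinct monomials have distinct weights. *)
Lemma meval_lin_indep (s : seq mon) (c : mon -> C) (m0 : mon) :
  uniq s -> m0 \in s -> c m0 != 0 -> exists x, \sum_(m <- s) c m * meval m x != 0.
Proof.
move=> us ms cm0; pose D := (\max_(m <- s) \max_t m t).+1.
have ltD m : m \in s -> forall t, (m t < D)%N.
  move=> hm t; rewrite ltnS (leq_trans (leq_bigmax t)) //.
  by rewrite (bigD1_seq m) //= leq_max leqnn.
pose P : {poly C} := \sum_(m <- s) c m *: 'X^(mweight D m).
have P0 : P != 0.
  apply: contraNneq cm0 => /(congr1 (fun p : {poly C} => p`_(mweight D m0))).
  rewrite coef0 coef_sum (bigD1_seq m0) //= coefZ coefXn eqxx mulr1.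
  rewrite big_seq_cond big1 ?addr0; first by move->.
  move=> m /andP[hm nm]; rewrite coefZ coefXn; case: eqP => [E|]; last by rewrite mulr0.
  by case/eqP: nm; apply: mweight_inj (esym E); apply: ltD.
have [z Hz] := poly_nonroot P0.
exists (fun t => z ^+ (D ^ enum_rank t)); apply: contra Hz => /eqP H.
rewrite -[X in _ == X]H; apply/eqP; rewrite horner_sum; apply: eq_bigr => m _.
rewrite hornerZ hornerXn /meval /mweight; congr (_ * _).
under [RHS]eq_bigr do rewrite -exprM mulnC.
by rewrite prodrXr.
Qed.

End Monomials.
End PolynomialFunctions.

Lemma seq_argmax (A : eqType) (s : seq A) (w : A -> nat) (a : A) :
  a \in s -> exists2 b, b \in s & forall c, c \in s -> (w c <= w b)%N.
Proof.
elim: s a => [//|a0 s IHs] a _; case: s IHs => [|a1 s] IHs.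
  by exists a0; rewrite ?mem_head // => c; rewrite inE => /eqP ->.
have [b bs Hb] := IHs a1 (mem_head _ _).
case: (leqP (w a0) (w b)) => [le|lt].
  by exists b => [|c]; rewrite inE; [rewrite bs orbT | move=> /orP[/eqP ->|/Hb]].
exists a0; rewrite ?mem_head // => c; rewrite inE => /orP[/eqP -> //|/Hb h].
exact: leq_trans h (ltnW lt).
Qed.

(** * Algebraic dependence on a set *)

Section AlgebraicDependence.
Variable R : realType.
Local Notation C := (R[i]).

(** For empty [Q] the relation is a nonzero constant, so [dep W f] then says that [W] is empty. *)
Definition dep (T Q : Type) (W : (T -> C) -> Prop) (f : Q -> (T -> C) -> C) : Prop :=
  exists G : (Q -> C) -> C,
    [/\ is_poly G, exists y, G y != 0 & forall x, W x -> G (fun i => f i x) = 0].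

Lemma lin_dep (E M : finType) (X : Type) (W : X -> Prop)
    (F : E -> X -> C) (B : M -> X -> C) (a : E -> M -> C) :
  (#|M| < #|E|)%N -> (forall e x, W x -> F e x = \sum_m a e m * B m x) ->
  exists2 v : E -> C, exists e, v e != 0 & forall x, W x -> \sum_e v e * F e x = 0.
Proof.
move=> lt HF; pose A := \matrix_(i < #|E|, j < #|M|) a (enum_val i) (enum_val j).
have /rowV0Pn[v /sub_kermxP vA v0] : kermx A != 0.
  rewrite kermx_eq0; apply: contraL lt => /eqP <-; rewrite -leqNgt; exact: rank_leq_col.
exists (fun e => v 0 (enum_rank e)).
  move: v0 => /rV0Pn[i vi]; exists (enum_val i); by rewrite enum_valK.
move=> x Wx; under eq_bigr => e _ do rewrite HF // mulr_sumr.
rewrite exchange_big big1 // => m _.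
under eq_bigr do rewrite mulrA.
rewrite -mulr_suml.
have /matrixP/(_ 0 (enum_rank m)) := vA; rewrite !mxE => Hm.
rewrite (_ : \sum_i _ = 0) ?mul0r // -[RHS]Hm {Hm}.
rewrite (reindex (@enum_val E E)) /=; last exact/onW_bij/enum_val_bij.
by apply: eq_bigr => i _; rewrite !mxE enum_valK enum_rankK.
Qed.

Section Span.
Variables (T : finType) (W : (T -> C) -> Prop).
Local Notation mon := {ffun T -> nat}.

(** The span of the monomials in [A], taken in the ring of functions on [W]. *)
Definition mspan (A : pred mon) (F : (T -> C) -> C) : Prop :=
  exists2 s : seq (C * mon), all (fun u => A u.2) s &
    forall x, W x -> F x = \sum_(u <- s) u.1 * meval u.2 x.

Lemma mspan_ext (A : pred mon) F G : (forall x, W x -> F x = G x) -> mspan A G -> mspan A F.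
Proof. by move=> H [s As Hs]; exists s => // x Wx; rewrite H ?Hs. Qed.

Lemma mspan_sub (A B : pred mon) F : (forall m, A m -> B m) -> mspan A F -> mspan B F.
Proof. by move=> AB [s As Hs]; exists s => //; apply: sub_all As => u; apply: AB. Qed.

Lemma mspan_meval (A : pred mon) m : A m -> mspan A (meval m).
Proof. by move=> Am; exists [:: (1, m)]; rewrite /= ?Am // => x _; rewrite big_seq1 mul1r. Qed.

Lemma mspan_sum (A : pred mon) (I : eqType) (s : seq I) (a : I -> C) F :
  (forall i, i \in s -> mspan A (F i)) -> mspan A (fun x => \sum_(i <- s) a i * F i x).
Proof.
elim: s => [|i s IHs] H; first by exists [::] => // x _; rewrite !big_nil.
have [s1 A1 H1] := H i (mem_head _ _).
have [j js|s2 A2 H2] := IHs _; first by apply: H; rewrite in_cons js orbT.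
exists ([seq (a i * u.1, u.2) | u <- s1] ++ s2).
  by rewrite all_cat all_map A2 andbT.
move=> x Wx; rewrite big_cons H2 // H1 // big_cat big_map mulr_sumr; congr (_ + _).
by apply: eq_bigr => u _; rewrite mulrA.
Qed.

Lemma mspan_trans (A B : pred mon) F :
  (forall m, A m -> mspan B (meval m)) -> mspan A F -> mspan B F.
Proof.
move=> AB [s /allP As Hs]; apply: mspan_ext Hs _; apply: mspan_sum => u us.
by apply: AB; apply: As.
Qed.

Lemma mspan_mul (A1 A2 A : pred mon) F1 F2 :
  (forall m1 m2, A1 m1 -> A2 m2 -> A [ffun t => (m1 t + m2 t)%N]) ->
  mspan A1 F1 -> mspan A2 F2 -> mspan A (fun x => F1 x * F2 x).
Proof.
move=> H [s1 A1s H1] [s2 A2s H2].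
apply: (@mspan_ext _ _ (fun x => \sum_(u <- s1) u.1 * \sum_(v <- s2) v.1 * (meval u.2 x * meval v.2 x))).
  move=> x Wx; rewrite H1 // H2 // mulr_suml; apply: eq_bigr => u _.
  rewrite -mulrA mulr_sumr; congr (_ * _); apply: eq_bigr => v _; exact: mulrCA.
apply: mspan_sum => u us; apply: mspan_sum => v vs.
apply: (@mspan_ext _ _ (meval [ffun t => (u.2 t + v.2 t)%N])) => [x _|].
  by rewrite mevalD.
by apply: mspan_meval; apply: H; [apply: (allP A1s) | apply: (allP A2s)].
Qed.

(** The monomial of largest weight in the relation is, on [W], a combination of lighter ones. [D]
    must exceed all exponents that occur, for the weights to be distinct; it is left free above [D0]
    so that one [D] can serve every [j]. *)
Lemma dep_lead k (j : 'I_k -> T) : injective j -> dep W (fun i x => x (j i)) ->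
  exists D0, forall D, (D0 <= D)%N -> exists m0 : mon,
    [/\ forall t, (m0 t < D)%N, forall t, (0 < m0 t)%N -> exists i, t = j i &
        mspan (fun m => (mweight D m < mweight D m0)%N) (meval m0)].
Proof.
move=> jinj [G [pG [y Gy] HG]].
have [s [c [us cs Gs]]] := is_poly_expand pG.
pose push (m : {ffun 'I_k -> nat}) : mon := [ffun t => (\sum_(i | j i == t) m i)%N].
have pushE (m : {ffun 'I_k -> nat}) i : push m (j i) = m i.
  by rewrite ffunE (big_pred1 i) // => i'; rewrite /= (inj_eq jinj).
have push_inj : injective push.
  by move=> m m' E; apply/ffunP => i; rewrite -!pushE E.
have meval_push (m : {ffun 'I_k -> nat}) (x : T -> C) : meval (push m) x = meval m (fun i => x (j i)).
  rewrite /meval [RHS](partition_big j xpredT) //=; apply: eq_bigr => t _.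
  rewrite ffunE -prodrXr; apply: eq_bigr => i /eqP -> //.
exists (\max_(m <- s) \max_t push m t).+1 => D hD.
have ltD (m : {ffun 'I_k -> nat}) : m \in s -> forall t, (push m t < D)%N.
  move=> ms t; apply: leq_ltn_trans hD; apply: leq_trans (leq_bigmax t) _.
  by rewrite (bigD1_seq m) //= leq_max leqnn.
have [m1 m1s] : exists m, m \in s.
  case: s {us cs ltD hD} Gs => [|m s] Gs; last by exists m; rewrite mem_head.
  by move: Gy; rewrite Gs big_nil eqxx.
have [m0 m0s Hm0] := seq_argmax (fun m => mweight D (push m)) m1s.
exists (push m0); split; first exact: ltD.
  move=> t; rewrite ffunE; case: (pickP (fun i => j i == t)) => [i /eqP <-|none].
    by exists i.
  by rewrite big_pred0.
apply: (@mspan_ext _ _ (fun x => \sum_(m <- rem m0 s) (- (c m / c m0)) * meval (push m) x)).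
  move=> x Wx; have := HG x Wx; rewrite Gs (big_rem m0) //= => /eqP.
  rewrite addr_eq0 -meval_push => /eqP E; apply: (mulfI (cs _ m0s)).
  rewrite E mulr_sumr -sumrN; apply: eq_bigr => m _.
  by rewrite meval_push mulrA mulrN mulrCA divff ?cs // mulr1 mulNr.
apply: mspan_sum => m ms; apply: mspan_meval.
have ms' : m \in s by apply: mem_rem ms.
rewrite ltn_neqAle Hm0 // andbT; apply/eqP => E.
move: ms; rewrite mem_rem_uniq // inE => /andP[/eqP nm _]; apply: nm.
by apply: push_inj; apply: mweight_inj E; apply: ltD.
Qed.

Definition standard (D k : nat) (m : mon) : bool := (#|[pred t | (D <= m t)%N]| < k)%N.

(** A monomial with [k] exponents at least [D] is a multiple of the leading monomial [m0] attached
    to these coordinates. Rewriting [m0] lowers the weight, so the process ends at standard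
    monomials. *)
Lemma standard_reduce D k :
  (forall j : 'I_k -> T, injective j -> exists m0 : mon,
    [/\ forall t, (m0 t < D)%N, forall t, (0 < m0 t)%N -> exists i, t = j i &
        mspan (fun m => (mweight D m < mweight D m0)%N) (meval m0)]) ->
  forall m, mspan (fun m' => standard D k m' && (mweight D m' <= mweight D m)%N) (meval m).
Proof.
move=> H m; have [w Hw] := ubnP (mweight D m); elim: w m Hw => // w IHw m Hw.
case sm: (standard D k m); first by apply: mspan_meval; rewrite sm leqnn.
have lek : (k <= #|[pred t | (D <= m t)%N]|)%N by rewrite leqNgt; apply/negbT.
have [j [jinj jD]] : exists j : 'I_k -> T, injective j /\ forall i, (D <= m (j i))%N.
  exists (fun i => enum_val (widen_ord lek i)); split.
    by move=> i i' /enum_val_inj /(congr1 val) /= E; apply: val_inj.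
  by move=> i; have := enum_valP (widen_ord lek i).
have [m0 [ltD supp sp0]] := H j jinj.
have le0 t : (m0 t <= m t)%N.
  case: (posnP (m0 t)) => [-> //|/supp[i ->]].
  exact: leq_trans (ltnW (ltD _)) (jD i).
pose m' : mon := [ffun t => (m t - m0 t)%N].
have mE : m = [ffun t => (m' t + m0 t)%N] by apply/ffunP => t; rewrite !ffunE subnK.
apply: (@mspan_trans (fun n => (mweight D n < mweight D m)%N)).
  move=> n ln; have lnw : (mweight D n < w)%N by apply: leq_trans ln _.
  apply: mspan_sub (IHw n lnw) => n' /= /andP[-> le'].
  exact: leq_trans le' (ltnW ln).
apply: (@mspan_ext _ _ (fun x => meval m' x * meval m0 x)) => [x _|].
  by rewrite -mevalD -mE.
apply: (mspan_mul _ (@mspan_meval (pred1 m') m' (eqxx _)) sp0).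
by move=> m1 m2 /eqP -> lt2; rewrite [in X in (_ < X)%N]mE !mweightD ltn_add2l.
Qed.

Lemma card_standard (O D k : nat) :
  (#|[pred m : {ffun T -> 'I_O.+1} | #|[pred t | (D < m t)%N]| < k.+1]|
    <= 2 ^ #|T| * D.+1 ^ #|T| * O.+1 ^ k)%N.
Proof.
(* The positions of the large exponents, the small exponents, and the list of the at most [k] large
   ones. The default values, [inord] of a large exponent and the padding [ord0], are never read
   back. *)
pose code (m : {ffun T -> 'I_O.+1}) :
    {ffun T -> bool} * {ffun T -> 'I_D.+1} * {ffun 'I_k -> 'I_O.+1} :=
  ([ffun t : T => (D < m t)%N], [ffun t : T => inord (m t)],
   [ffun i : 'I_k => nth ord0 [seq m t | t <- enum [pred t | (D < m t)%N]] i]).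
have -> : (2 ^ #|T| * D.+1 ^ #|T| * O.+1 ^ k)%N =
    #|{: {ffun T -> bool} * {ffun T -> 'I_D.+1} * {ffun 'I_k -> 'I_O.+1}}|.
  by rewrite !card_prod !card_ffun card_bool !card_ord.
rewrite -(@card_in_imset _ _ code) ?max_card //.
move=> m1 m2; rewrite !inE => h1 h2 [/ffunP E1 /ffunP E2 /ffunP E3].
have EP : [pred t | (D < m1 t)%N] =i [pred t | (D < m2 t)%N].
  by move=> t; have := E1 t; rewrite !ffunE !inE.
apply/ffunP => t; case: (ltnP D (m1 t)) => [lt|le].
  have tin : t \in enum [pred t | (D < m1 t)%N] by rewrite mem_enum.
  have li : (index t (enum [pred t | (D < m1 t)%N]) < k)%N.
    by rewrite -ltnS; apply: leq_trans h1; rewrite ltnS cardE index_mem.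
  have := E3 (Ordinal li); rewrite !ffunE /= -(eq_enum EP).
  by rewrite !(nth_map t) ?index_mem ?nth_index.
have le2 : (m2 t <= D)%N.
  by have := EP t; rewrite !inE (leqNgt (m2 t)) => <-; rewrite -leqNgt.
have := congr1 val (E2 t); rewrite !ffunE /= !inordK // => E; exact: val_inj.
Qed.

End Span.

(* Counting argument: modulo W the monomials of weight <= B in T reduce to the standard ones,
   which number O(B ^ (k-1)), against B ^ #|Q| monomials in f with exponents < B. *)
Lemma dep_growth (T Q : finType) (W : (T -> C) -> Prop) (f : Q -> (T -> C) -> C) k :
  (k <= #|Q|)%N ->
  (forall j : 'I_k -> T, injective j -> dep W (fun i x => x (j i))) ->
  (forall i, is_poly (f i)) -> dep W f.
Proof.
move=> kQ depj pf.
(* Indexing by finite functions leaves finitely many [j], so the bounds [D0 j] have a maximum. *)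
have [D0 HD0] : exists D0 : {ffun 'I_k -> T} -> nat, forall j : {ffun 'I_k -> T}, injective j ->
    forall D, (D0 j <= D)%N -> exists m0 : {ffun T -> nat},
    [/\ forall t, (m0 t < D)%N, forall t, (0 < m0 t)%N -> exists i, t = j i &
        mspan W (fun m => (mweight D m < mweight D m0)%N) (meval m0)].
  suff /choice[D0 H] : forall j : {ffun 'I_k -> T}, exists D0, injective j ->
    forall D, (D0 <= D)%N -> exists m0 : {ffun T -> nat},
    [/\ forall t, (m0 t < D)%N, forall t, (0 < m0 t)%N -> exists i, t = j i &
        mspan W (fun m => (mweight D m < mweight D m0)%N) (meval m0)] by exists D0.
  move=> j; case: (pselect (injective j)) => [ji|nj]; last by exists 0%N => /nj.
  by have [D0 H] := dep_lead ji (depj j ji); exists D0.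
pose D := (\max_j D0 j).+1.
have red m : mspan W (fun m' => standard D k m' && (mweight D m' <= mweight D m)%N) (meval m).
  apply: standard_reduce => j ji.
  have ji' : injective [ffun i => j i] by move=> a b; rewrite !ffunE => /ji.
  have [|m0 [h1 h2 h3]] := HD0 _ ji' D; first exact/leqW/leq_bigmax.
  by exists m0; split=> // t ht; have [i ->] := h2 t ht; exists i; rewrite ffunE.
have Dp : (0 < D)%N by [].
(* For [k = 0] no monomial is standard, so 1 is an empty sum on [W], which is therefore empty. *)
case: k kQ depj D0 HD0 D Dp red => [|k] kQ depj D0 HD0 D Dp red.
  exists (fun=> 1); split; [exact: poly_const|by exists (fun=> 0); rewrite oner_eq0|].
  move=> x Wx; have [s As Hs] := red [ffun=> 0%N].
  rewrite -(meval0 x) Hs //; case: s As {Hs} => [|u s] //=; by rewrite big_nil.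
have [w Hw] : exists w, forall i, mspan W (fun m => (mweight D m <= w)%N) (f i).
  have /choice[s Hs] i := is_poly_terms (pf i).
  exists (\max_i \max_(u <- s i) mweight D u.2)%N => i; exists (s i) => //.
  apply/allP => u us; apply: leq_trans (leq_bigmax i).
  by rewrite (big_rem u) //= leq_max leqnn.
have Hpow (e : {ffun Q -> nat}) :
    mspan W (fun m => (mweight D m <= \sum_i w * e i)%N) (fun x => \prod_i f i x ^+ e i).
  have mspan_1 (b : nat) : mspan W (fun m => (mweight D m <= b)%N) (fun=> 1).
    apply: (@mspan_ext _ _ _ _ (meval [ffun=> 0%N])) => [x _|]; first by rewrite meval0.
    by apply: mspan_meval; rewrite /mweight big1 // => t _; rewrite ffunE.
  have mspanM (b1 b2 : nat) F1 F2 : mspan W (fun m => (mweight D m <= b1)%N) F1 ->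
      mspan W (fun m => (mweight D m <= b2)%N) F2 ->
      mspan W (fun m => (mweight D m <= b1 + b2)%N) (fun x => F1 x * F2 x).
    by apply: mspan_mul => m1 m2 h1 h2; rewrite mweightD leq_add.
  elim: (index_enum Q) => [|i s IHs].
    rewrite big_nil; apply: mspan_ext (mspan_1 _) => x _; by rewrite big_nil.
  rewrite big_cons; apply: (@mspan_ext _ _ _ _ (fun x => f i x ^+ e i * \prod_(i <- s) f i x ^+ e i)).
    by move=> x _; rewrite big_cons.
  apply: (mspanM) IHs; elim: (e i) => [|n IHn].
    by apply: mspan_ext (mspan_1 _) => x _; rewrite expr0.
  rewrite mulnS; apply: (@mspan_ext _ _ _ _ (fun x => f i x * f i x ^+ n)); last exact: mspanM.
  by move=> x _; rewrite exprS.
(* Products with exponents below [B] have weight at most [O], and [O.+1 <= (w * q).+1 * B]. Hence at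
   most [(2 * D) ^ #|T| * ((w * q).+1 * B) ^ k] standard monomials occur, which is less than
   [B ^ k.+1] by the choice of [B]. *)
pose q := #|Q|; pose B := ((2 * D) ^ #|T| * (w * q).+1 ^ k).+1.
pose O := (w * (q * B))%N.
(* Since [D > 0], weight at most [O] bounds every exponent by [O], so [M] contains all the standard
   monomials needed. *)
pose M : finType := {m : {ffun T -> 'I_O.+1} | (#|[pred t | (D <= m t)%N]| < k.+1)%N}.
pose emb (m : M) : {ffun T -> nat} := [ffun t => val m t : nat].
have emb_inj : injective emb.
  move=> m1 m2 /ffunP E; apply: val_inj; apply/ffunP => t; apply: val_inj.
  by have := E t; rewrite !ffunE.
have embP m : standard D k.+1 m && (mweight D m <= O)%N -> exists m', emb m' = m.
  case/andP=> sm wm.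
  have ltO t : (m t < O.+1)%N.
    rewrite ltnS (leq_trans _ wm) // /mweight (bigD1 t) //= (leq_trans _ (leq_addr _ _)) //.
    by rewrite leq_pmulr // expn_gt0 Dp.
  have sm' : (#|[pred t | (D <= ([ffun t => Ordinal (ltO t)] : {ffun T -> 'I_O.+1}) t)%N]| < k.+1)%N.
    by rewrite (eq_card (B := [pred t | (D <= m t)%N])) // => t; rewrite !inE ffunE.
  by exists (Sub ([ffun t => Ordinal (ltO t)] : {ffun T -> 'I_O.+1}) sm' : M); apply/ffunP => t; rewrite !ffunE.
have /choice[a Ha] : forall e : {ffun Q -> 'I_B}, exists a : M -> C, forall x, W x ->
    \prod_i f i x ^+ e i = \sum_m a m * meval (emb m) x.
  move=> e; have := Hpow [ffun i => e i : nat].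
  have sub m : (mweight D m <= \sum_i w * [ffun i => e i : nat] i)%N ->
     mspan W (fun m' => standard D k.+1 m' && (mweight D m' <= O)%N) (meval m).
    move=> hm; apply: mspan_sub (red m) => m' /= /andP[-> le']; apply: leq_trans le' _.
    apply: leq_trans hm _; rewrite -big_distrr /= leq_mul2l; apply/orP; right.
    rewrite -sum_nat_const; apply: leq_sum => i _; rewrite ffunE; exact: ltnW.
  move=> /(mspan_trans sub)[s /allP As Hs].
  exists (fun m => \sum_(u <- s | u.2 == emb m) u.1) => x Wx.
  have -> : \prod_i f i x ^+ e i = \prod_i f i x ^+ [ffun i => e i : nat] i.
    by apply: eq_bigr => i _; rewrite ffunE.
  rewrite Hs //; under [RHS]eq_bigr => m _.
    rewrite mulr_suml big_mkcond /=.
    over.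
  rewrite exchange_big /= big_seq [RHS]big_seq; apply: eq_bigr => u us.
  have [m' Em'] := embP _ (As _ us).
  rewrite (bigD1 m') //= Em' eqxx big1 ?addr0 // => m nm.
  by rewrite -Em' (inj_eq emb_inj) eq_sym (negPf nm).
have ltM : (#|M| < #|{ffun Q -> 'I_B}|)%N.
  rewrite card_ffun card_ord card_sig.
  have -> : #|[pred m : {ffun T -> 'I_O.+1} | (#|[pred t | (D <= m t)%N]| < k.+1)%N]| =
      #|[pred m : {ffun T -> 'I_O.+1} | (#|[pred t | (D.-1 < m t)%N]| < k.+1)%N]|.
    by apply: eq_card => m; rewrite !inE prednK.
  apply: leq_ltn_trans (card_standard T O D.-1 k) _; rewrite prednK // -expnMn.
  apply: (@leq_trans (B ^ k.+1)); last by rewrite leq_pexp2l.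
  apply: (@leq_ltn_trans ((2 * D) ^ #|T| * ((w * q).+1 ^ k * B ^ k))).
    have le : (O.+1 <= (w * q).+1 * B)%N.
      by rewrite mulSn /O mulnA -[X in (X <= _)%N]add1n leq_add2r.
    rewrite leq_mul2l -expnMn; apply/orP; right.
    by case: (posnP k) => [->|k0]; rewrite ?expn0 // leq_exp2r.
  by rewrite mulnA expnS ltn_pmul2r ?expn_gt0.
have [v [e ve] Hv] := lin_dep ltM Ha.
pose ext (e : {ffun Q -> 'I_B}) : {ffun Q -> nat} := [ffun i => e i : nat].
exists (fun y => \sum_e v e * meval (ext e) y); split.
- apply: is_poly_sum => e' _; apply: poly_mul; [exact: poly_const | exact: is_poly_meval].
- have ext_inj : injective ext.
    move=> m1 m2 /ffunP E; apply/ffunP => t; apply: val_inj.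
    by have := E t; rewrite !ffunE.
  pose c m := if [pick e | ext e == m] is Some e then v e else 0.
  have cE e' : c (ext e') = v e'.
    by rewrite /c; case: pickP => [e'' /eqP /ext_inj -> //|/(_ e')]; rewrite eqxx.
  have [|||y Hy] := @meval_lin_indep R _ [seq ext e | e <- index_enum _] c (ext e).
  + by rewrite map_inj_uniq // index_enum_uniq.
  + by rewrite map_f ?mem_index_enum.
  + by rewrite cE.
  exists y; move: Hy; rewrite big_map.
  by under eq_bigr do rewrite cE.
- move=> x Wx; rewrite -[RHS](Hv x Wx); apply: eq_bigr => e' _; congr (_ * _).
  by apply: eq_bigr => i _; rewrite ffunE.
Qed.

End AlgebraicDependence.

(** * Chains of irreducible closed sets and algebraic independence *)

Section ChainsAndDependence.
Variable R : realType.
Local Notation C := (R[i]).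

Lemma zclosed_zero (T : finType) (p : (T -> C) -> C) :
  is_poly p -> zclosed (fun x => p x = 0).
Proof.
move=> pp; exists (fun q => q = p); split=> [q -> //|x]; split=> [px q -> //|]; exact.
Qed.

Lemma zclosed_vanish (T : finType) (W : (T -> C) -> Prop) x :
  zclosed W -> ~ W x -> exists p, [/\ is_poly p, forall y, W y -> p y = 0 & p x != 0].
Proof.
move=> [S [pS WS]] nWx.
have /existsNP[p /not_implyP[Sp px]] : ~ forall p, S p -> p x = 0 by move/WS.
by exists p; split; [exact: pS | move=> y /WS /(_ p Sp) | apply/eqP].
Qed.

Lemma irreducible_mul_eq0 (T : finType) (Y : (T -> C) -> Prop) (p q : (T -> C) -> C) :
  irreducible (@zclosed R T) Y -> is_poly p -> is_poly q ->
  (forall x, Y x -> p x * q x = 0) ->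
  (forall x, Y x -> p x = 0) \/ (forall x, Y x -> q x = 0).
Proof.
move=> [_ irr] pp pq H; apply: irr; [exact: zclosed_zero | exact: zclosed_zero |].
by move=> y /H /eqP; rewrite mulf_eq0 => /orP[] /eqP; [left|right].
Qed.

(* A relation between f_1, ..., f_k on c_k can be divided by the largest power of f_k in it,
   then restricted to c_(k-1), where f_k vanishes. *)
Lemma chain_indep (T : finType) (c : nat -> (T -> C) -> Prop) m :
  (forall k, (k <= m)%N -> zclosed (c k) /\ irreducible (@zclosed R T) (c k)) ->
  (forall k, (k < m)%N -> (forall y, c k y -> c k.+1 y) /\ exists y, c k.+1 y /\ ~ c k y) ->
  exists2 f : 'I_m -> (T -> C) -> C, forall i, is_poly (f i) & ~ dep (c m) f.
Proof.
move=> cirr cstrict.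
have /choice[f Hf] : forall k, exists p : (T -> C) -> C, is_poly p /\
    ((k < m)%N -> (forall y, c k y -> p y = 0) /\ exists2 y, c k.+1 y & p y != 0).
  move=> k; case: (ltnP k m) => [lt|_]; last by exists (fun=> 0); split=> //; exact: poly_const.
  have [_ [y [cy ncy]]] := cstrict k lt.
  have [p [pp p0 py]] := zclosed_vanish (cirr k (ltnW lt)).1 ncy.
  by exists p; split=> // _; split=> //; exists y.
exists (fun i => f i) => [i|]; first exact: (Hf i).1.
suff H k : (k <= m)%N -> ~ dep (c k) (fun i : 'I_k => f i) by exact: H.
elim: k => [_|k IHk lekm] [G [pG [y Gy] HG]].
  have [[x cx] _] := (cirr 0%N (leq0n _)).2.
  by move/eqP: Gy; apply; rewrite -[RHS](HG x cx); congr G; apply/funext; case.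
have [fk0 [z cz fz]] := (Hf k).2 lekm.
have irrc := (cirr k.+1 lekm).2.
have [s [cf [us cfs Gs]]] := is_poly_expand pG.
pose res (n : {ffun 'I_k.+1 -> nat}) : {ffun 'I_k -> nat} := [ffun j => n (widen_ord (leqnSn k) j)].
have [m1 m1s] : exists n, n \in s.
  case: s {us cfs} Gs => [|n s] Gs; last by exists n; rewrite mem_head.
  by move: Gy; rewrite Gs big_nil eqxx.
have exP : exists e, has (fun n : {ffun 'I_k.+1 -> nat} => n ord_max == e) s.
  by exists (m1 ord_max); apply/hasP; exists m1.
(* [e] is the largest power of the last variable dividing the relation. *)
have [e /hasP[m0 m0s /eqP m0e] emin] := ex_minnP exP.
have lee n : n \in s -> (e <= n ord_max)%N.
  by move=> ns; apply: emin; apply/hasP; exists n.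
pose F (n : {ffun 'I_k.+1 -> nat}) x := cf n * meval (res n) (fun i => f i x).
have pF n : is_poly (F n).
  apply: poly_mul; first exact: poly_const.
  apply: (@is_poly_comp R T 'I_k (meval (res n)) (fun i => f i)) => [|i]; [exact: is_poly_meval | exact: (Hf i).1].
have GF x : G (fun i => f i x) = f k x ^+ e * \sum_(n <- s) F n x * f k x ^+ (n ord_max - e).
  rewrite Gs mulr_sumr big_seq [RHS]big_seq; apply: eq_bigr => n ns.
  rewrite {1}/meval big_ord_recr /= -{1}(subnK (lee n ns)) exprD.
  rewrite (_ : \prod_(i < k) _ = meval (res n) (fun i => f i x)); last first.
    by apply: eq_bigr => i _; rewrite ffunE.
  by rewrite /F; ring.
have [||x cx|H|H] := irreducible_mul_eq0 (p := fun x => f k x ^+ e)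
    (q := fun x => \sum_(n <- s) F n x * f k x ^+ (n ord_max - e)) irrc.
- by apply: is_poly_exp; apply: (Hf k).1.
- by apply: is_poly_sum => n _; apply: poly_mul => //; apply: is_poly_exp; apply: (Hf k).1.
- by rewrite -GF HG.
- by have /eqP := H z cz; rewrite (negPf (expf_neq0 _ fz)).
(* The quotient vanishes on [c k.+1], hence on [c k], where [f k] is zero and only the terms with
   exponent exactly [e] remain. As [res] is injective on these, they still form a nonzero
   polynomial. *)
apply: IHk; first exact: ltnW.
exists (fun y => \sum_(n <- s | n ord_max == e) cf n * meval (res n) y); split.
- apply: is_poly_sum => n _; apply: poly_mul; [exact: poly_const | exact: is_poly_meval].
- pose ext (n : {ffun 'I_k -> nat}) : {ffun 'I_k.+1 -> nat} :=
    [ffun i => if unlift ord_max i is Some j then n j else e].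
  have liftE (j : 'I_k) : lift ord_max j = widen_ord (leqnSn k) j.
    by apply: val_inj; rewrite /= /bump leqNgt ltn_ord add0n.
  have extK (n : {ffun 'I_k.+1 -> nat}) : n ord_max == e -> ext (res n) = n.
    move=> /eqP ne; apply/ffunP => i; rewrite ffunE; case: unliftP => [j ->|->]; last by rewrite ne.
    by rewrite ffunE liftE.
  have [|||y' Hy] := @meval_lin_indep R _ [seq res n | n : {ffun 'I_k.+1 -> nat} <- s & n ord_max == e] (fun n => cf (ext n)) (res m0).
  + rewrite map_inj_in_uniq ?filter_uniq // => n1 n2.
    by rewrite !mem_filter => /andP[/extK E1 _] /andP[/extK E2 _] E; rewrite -E1 E E2.
  + by apply/map_f; rewrite mem_filter m0e eqxx.
  + by rewrite extK ?m0e // cfs.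
  exists y'; move: Hy; rewrite big_map big_filter.
  by under eq_bigr => n ne do rewrite extK //.
- move=> x cx; have [sub _] := cstrict k lekm; rewrite -[RHS](H x (sub _ cx)).
  rewrite big_mkcond /= big_seq [RHS]big_seq; apply: eq_bigr => n ns.
  rewrite fk0 // expr0n subn_eq0 eqn_leq lee // andbT.
  by case: ifP; rewrite ?mulr1 ?mulr0.
Qed.

(** With [#|Q| = m], [dep_growth] passes from the dependence of coordinates to that of arbitrary
    functions, such as those of [chain_indep]. *)
Lemma dep_no_chain (T : finType) (W : (T -> C) -> Prop) (c : nat -> (T -> C) -> Prop) m :
  (forall k, (k <= m)%N -> zclosed (c k) /\ irreducible (@zclosed R T) (c k)) ->
  (forall k, (k < m)%N -> (forall y, c k y -> c k.+1 y) /\ exists y, c k.+1 y /\ ~ c k y) ->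
  (forall x, c m x -> W x) ->
  ~ (forall j : 'I_m -> T, injective j -> dep W (fun i x => x (j i))).
Proof.
move=> cirr cstrict cW depW; have [f pf nf] := chain_indep cirr cstrict.
apply: nf; have [|G [pG nG HG]] := @dep_growth R _ _ W f m _ depW pf.
  by rewrite card_ord.
by exists G; split=> // x /cW; apply: HG.
Qed.

End ChainsAndDependence.

(** * The Zariski topology is Noetherian *)

Section HilbertBasis.

Definition lin_comb (A : comNzRingType) (n : nat) (f : nat -> A) (p : A) : Prop :=
  exists c : nat -> A, p = \sum_(i < n) c i * f i.

(* Sequential form of "every ideal is finitely generated". *)
Definition noetherian (A : comNzRingType) : Prop :=
  forall f : nat -> A, exists k, lin_comb k f (f k).

Lemma lin_comb_add (A : comNzRingType) n (f : nat -> A) p q a :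
  lin_comb n f p -> lin_comb n f q -> lin_comb n f (p + a * q).
Proof.
move=> [c ->] [e ->]; exists (fun i => c i + a * e i).
by rewrite mulr_sumr -big_split; apply: eq_bigr => i _ /=; rewrite mulrDl mulrA.
Qed.

Lemma lin_comb0 (A : comNzRingType) n (f : nat -> A) : lin_comb n f 0.
Proof. by exists (fun=> 0); rewrite big1 // => i _; rewrite mul0r. Qed.

Lemma lin_comb_sum (A : comNzRingType) n (f : nat -> A) k (a p : nat -> A) :
  (forall i, (i < k)%N -> lin_comb n f (p i)) -> lin_comb n f (\sum_(i < k) a i * p i).
Proof.
elim: k => [|k IHk] H; first by rewrite big_ord0; apply: lin_comb0.
rewrite big_ord_recr /=; apply: lin_comb_add; last exact: H.
by apply: IHk => i lt; apply/H/leqW.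
Qed.

Lemma lin_comb_gen (A : comNzRingType) n (f : nat -> A) i : (i < n)%N -> lin_comb n f (f i).
Proof.
move=> lt; exists (fun j => (j == i)%:R); rewrite (bigD1 (Ordinal lt)) //= eqxx mul1r.
by rewrite big1 ?addr0 // => j; rewrite -val_eqE /= => /negPf ->; rewrite mul0r.
Qed.

Lemma lin_comb_leq (A : comNzRingType) n m (f : nat -> A) p :
  (n <= m)%N -> lin_comb n f p -> lin_comb m f p.
Proof.
by move=> le [c ->]; apply: lin_comb_sum => i lt; apply: lin_comb_gen (leq_trans lt le).
Qed.

Lemma noetherian_field (F : fieldType) : noetherian F.
Proof.
move=> f; case: (eqVneq (f 0%N) 0) => [f0|f0].
  by exists 0%N; rewrite f0; apply: lin_comb0.
by exists 1%N, (fun=> f 1%N / f 0%N); rewrite big_ord1 divfK.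
Qed.

(** Hilbert's argument: [g k] has least size among the elements of the ideal of [f] outside the
    ideal of the earlier ones. A relation between leading coefficients then gives [q], which is
    smaller and still outside. *)
Lemma noetherian_poly (A : comNzRingType) : noetherian A -> noetherian {poly A}.
Proof.
move=> nA f; apply: contrapT => /forallNP nf.
pose I (p : {poly A}) := exists n, lin_comb n f p.
have exg (s : seq {poly A}) : exists p : {poly A}, (forall q, q \in s -> I q) ->
    [/\ I p, ~ lin_comb (size s) (nth 0 s) p &
        forall q, I q -> ~ lin_comb (size s) (nth 0 s) q -> (size p <= size q)%N].
  case: (pselect (forall q, q \in s -> I q)) => [sI|n]; last by exists 0 => /n.
  pose P m := `[< exists p : {poly A}, [/\ I p, ~ lin_comb (size s) (nth 0 s) p & size p = m] >].
  have exP : exists m, P m.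
    (* Otherwise the finite list [s] generates the ideal; as [s] lies in the span of the first [n]
       terms of [f], so does [f n], against [nf]. *)
    apply: contrapT => /forallNP nP.
    have all p : I p -> lin_comb (size s) (nth 0 s) p.
      by move=> Ip; apply: contrapT => np; apply: (nP (size p)); apply/asboolP; exists p.
    have [n Hn] : exists n, forall q, q \in s -> lin_comb n f q.
      elim: s sI {P nP all} => [|q s IHs] sI; first by exists 0%N.
      have [n1 H1] := sI q (mem_head _ _).
      have [q' q's|n2 H2] := IHs _; first by apply: sI; rewrite in_cons q's orbT.
      exists (maxn n1 n2) => q'; rewrite in_cons => /orP[/eqP ->|/H2 h].
        exact: lin_comb_leq (leq_maxl _ _) H1.
      exact: lin_comb_leq (leq_maxr _ _) h.
    apply: (nf n); have [|c ->] := all (f n).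
      by exists n.+1; apply: lin_comb_gen.
    by apply: lin_comb_sum => i lt; apply/Hn/mem_nth.
  have [m /asboolP[p [Ip np sp]] mmin] := ex_minnP exP.
  exists p => _; split=> // q Iq nq; rewrite sp; apply: mmin.
  by apply/asboolP; exists q.
have [nx Hnx] := choice exg.
pose gs := fix gs k := if k is k'.+1 then rcons (gs k') (nx (gs k')) else [::].
pose g k := nx (gs k).
have gsE k : gs k = mkseq g k.
  elim: k => [//|k IHk]; by rewrite /= -/(g k) IHk /mkseq -addn1 iotaD map_cat /= add0n cats1.
have lcE k p : lin_comb (size (gs k)) (nth 0 (gs k)) p <-> lin_comb k g p.
  rewrite gsE size_mkseq; split=> -[c ->]; exists c; apply: eq_bigr => i _;
  by rewrite nth_mkseq.
have gsI k : forall q, q \in gs k -> I q.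
  elim: k => [|k IHk] q //=; rewrite mem_rcons in_cons => /orP[/eqP ->|]; last exact: IHk.
  by have [] := Hnx _ IHk.
have gI k : I (g k) by have [] := Hnx _ (gsI k).
have gn k : ~ lin_comb k g (g k) by have [_ /lcE] := Hnx _ (gsI k).
have gmin k q : I q -> ~ lin_comb k g q -> (size (g k) <= size q)%N.
  by move=> Iq nq; have [_ _ H] := Hnx _ (gsI k); apply: H => // /lcE.
have g0 k : g k != 0 by apply: contra_notN (gn k) => /eqP ->; apply: lin_comb0.
have gle i k : (i <= k)%N -> (size (g i) <= size (g k))%N.
  by move=> le; apply: gmin (gI k) _ => /(lin_comb_leq le); apply: gn.
have [k [c Hc]] := nA (fun k => lead_coef (g k)).
pose e i := c i *: 'X^(size (g k) - size (g i)).
pose q := g k + (-1) * \sum_(i < k) e i * g i.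
have Iq : I q.
  have [n Hn] : exists n, forall i, (i <= k)%N -> lin_comb n f (g i).
    elim: (k) => [|j [n IHj]].
      by have [n Hn] := gI 0%N; exists n => i; rewrite leqn0 => /eqP ->.
    have [n' Hn'] := gI j.+1; exists (maxn n n') => i.
    rewrite leq_eqVlt => /orP[/eqP ->|/IHj h].
      exact: lin_comb_leq (leq_maxr _ _) Hn'.
    exact: lin_comb_leq (leq_maxl _ _) h.
  exists n; apply: lin_comb_add; first exact: Hn.
  by apply: lin_comb_sum => i /ltnW; apply: Hn.
have nq : ~ lin_comb k g q.
  move=> hq; apply: (gn k).
  rewrite [g k](_ : _ = q + 1 * \sum_(i < k) e i * g i); last by rewrite /q; ring.
  by apply: lin_comb_add hq _; exists e.
have := gmin k q Iq nq; apply/negP; rewrite -ltnNge.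
have sk : (0 < size (g k))%N by rewrite size_poly_gt0.
rewrite -[X in (_ < X)%N](prednK sk) ltnS; apply/leq_sizeP => j hj.
rewrite /q mulN1r coefB coef_sum.
have termE (i : 'I_k) : (e i * g i)`_j = c i * (g i)`_(j - (size (g k) - size (g i))).
  rewrite /e -scalerAl coefZ coefXnM ltnNge (leq_trans _ hj) //.
  have := gle i k (ltnW (ltn_ord i)); have : (0 < size (g i))%N by rewrite size_poly_gt0.
  by lia.
under eq_bigr do rewrite termE.
have [->|nj] := eqVneq j (size (g k)).-1.
  apply/eqP; rewrite subr_eq0 -/(lead_coef (g k)) Hc; apply/eqP; apply: eq_bigr => i _.
  congr (_ * _); rewrite lead_coefE; congr (_`_ _).
  have := gle i k (ltnW (ltn_ord i)); have : (0 < size (g i))%N by rewrite size_poly_gt0.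
  by lia.
have lej : (size (g k) <= j)%N by rewrite -(prednK sk) ltn_neqAle eq_sym nj hj.
rewrite [(g k)`_j]nth_default //.
rewrite big1 ?subr0 // => i _; rewrite nth_default ?mulr0 //.
have := gle i k (ltnW (ltn_ord i)); move: lej; move: (size (g k)) (size (g i)) => a b; lia.
Qed.

Variable R : realType.
Local Notation C := (R[i]).

(** Polynomial functions on a finite type are evaluations of elements of this iterated one-variable
    ring, to which the basis theorem applies by induction. *)
Fixpoint iter_poly (n : nat) : comNzRingType :=
  if n is n'.+1 then {poly (iter_poly n')} else C.

Lemma noetherian_iter_poly n : noetherian (iter_poly n).
Proof. by elim: n => [|n IHn]; [exact: noetherian_field | exact: noetherian_poly]. Qed.

Fixpoint iter_eval (n : nat) (x : nat -> C) : {rmorphism iter_poly n -> C} :=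
  match n return {rmorphism iter_poly n -> C} with
  | 0%N => GRing.RMorphism.clone _ _ (@idfun C) _
  | n'.+1 => GRing.RMorphism.clone _ _ (horner_eval (x n') \o map_poly (iter_eval n' x)) _
  end.

Lemma iter_evalC n (p : iter_poly n) x : iter_eval n.+1 x p%:P = iter_eval n x p.
Proof. by rewrite /= map_polyC /horner_eval hornerC. Qed.

Lemma iter_evalX n x : iter_eval n.+1 x 'X = x n.
Proof. by rewrite /= map_polyX /horner_eval hornerX. Qed.

Lemma iter_poly_const n (c : C) : exists p : iter_poly n, forall x, iter_eval n x p = c.
Proof.
elim: n => [|n [p Hp]]; first by exists c.
by exists p%:P => x; rewrite iter_evalC.
Qed.

Lemma iter_poly_var n i : (i < n)%N -> exists p : iter_poly n, forall x, iter_eval n x p = x i.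
Proof.
elim: n => // n IHn; rewrite ltnS leq_eqVlt => /orP[/eqP ->|/IHn[p Hp]].
  by exists 'X => x; rewrite iter_evalX.
by exists p%:P => x; rewrite iter_evalC.
Qed.

Lemma is_poly_iter (T : finType) (p : (T -> C) -> C) : is_poly p ->
  exists P : iter_poly #|T|, forall x : nat -> C,
    p (fun t => x (enum_rank t)) = iter_eval #|T| x P.
Proof.
elim=> [c|t|p1 p2 _ [P1 H1] _ [P2 H2]|p1 p2 _ [P1 H1] _ [P2 H2]].
- by have [P HP] := iter_poly_const #|T| c; exists P => x.
- by have [P HP] := iter_poly_var (ltn_ord (enum_rank t)); exists P => x.
- by exists (P1 + P2) => x; rewrite rmorphD H1 H2.
- by exists (P1 * P2) => x; rewrite rmorphM H1 H2.
Qed.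

(** If every step were strict, take [f k] vanishing on [W k.+1] but not on [W k]. Some [f k] is then
    a combination of the earlier [f i], all of which vanish on [W k]. *)
Lemma zclosed_dcc (T : finType) (W : nat -> (T -> C) -> Prop) :
  (forall k, zclosed (W k)) -> (forall k x, W k.+1 x -> W k x) ->
  exists k, forall x, W k x -> W k.+1 x.
Proof.
move=> cW dW; apply: contrapT => /forallNP nW.
have /choice[f Hf] : forall k, exists p : (T -> C) -> C,
    [/\ is_poly p, forall y, W k.+1 y -> p y = 0 & exists2 x, W k x & p x != 0].
  move=> k; have /existsNP[x /not_implyP[Wx nWx]] := nW k.
  by have [p [pp p0 px]] := zclosed_vanish (cW k.+1) nWx; exists p; split=> //; exists x.
have /choice[F HF] k : exists P : iter_poly #|T|, forall x : nat -> C,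
    f k (fun t => x (enum_rank t)) = iter_eval #|T| x P.
  by apply: is_poly_iter; have [] := Hf k.
have [k [c Hc]] := @noetherian_iter_poly #|T| F.
have [_ _ [x Wx /eqP]] := Hf k; apply.
pose x' i := if insub i is Some r then x (@enum_val T T r) else 0.
have xE : x = fun t => x' (enum_rank t).
  by apply/funext => t; rewrite /x' valK enum_rankK.
rewrite xE HF Hc rmorph_sum big1 // => i _; rewrite rmorphM -HF -xE.
have mono a b : (a <= b)%N -> W b x -> W a x.
  by move=> /subnK <-; elim: (b - a)%N => // n IHn /dW.
by have [_ H0 _] := Hf i; rewrite H0 ?mulr0 //; apply: mono Wx.
Qed.

End HilbertBasis.

(** * Irreducible decomposition and construction of chains *)

Section Decomposition.
Variable R : realType.
Local Notation C := (R[i]).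

Section OneSpace.
Variable T : finType.
Local Notation set := ((T -> C) -> Prop).

Lemma zclosed_iff (V W : set) : (forall x, V x <-> W x) -> zclosed V -> zclosed W.
Proof.
by move=> VW [S [pS HS]]; exists S; split=> // x; rewrite -HS -VW.
Qed.

Lemma zclosed_and (V W : set) : zclosed V -> zclosed W -> zclosed (fun x => V x /\ W x).
Proof.
move=> [S [pS HS]] [S' [pS' HS']]; exists (fun p => S p \/ S' p); split.
  by move=> p [/pS|/pS'].
move=> x; rewrite HS HS'; split=> [[h h'] p [/h|/h'] //|h].
by split=> p Sp; apply: h; [left|right].
Qed.

Lemma zclosed_or (V W : set) : zclosed V -> zclosed W -> zclosed (fun x => V x \/ W x).
Proof.
move=> [S [pS HS]] [S' [pS' HS']].
exists (fun r => exists p q, [/\ S p, S' q & r = fun x => p x * q x]); split.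
  by move=> r [p [q [/pS pp /pS' pq ->]]]; apply: poly_mul.
move=> x; rewrite HS HS'; split=> [[h|h] r [p [q [Sp Sq ->]]]|h].
- by rewrite h ?mul0r.
- by rewrite (h q) ?mulr0.
apply: contrapT => /not_orP[/existsNP[p /not_implyP[Sp /eqP px]]].
move=> /existsNP[q /not_implyP[Sq /eqP qx]].
have /eqP := h (fun x => p x * q x) (ex_intro _ p (ex_intro _ q (And3 Sp Sq erefl))).
by rewrite mulf_eq0 (negPf px) (negPf qx).
Qed.

Lemma zclosed_point (a : T -> C) : zclosed (fun x => x = a).
Proof.
exists (fun p => exists t, p = fun x => x t - a t); split.
  by move=> p [t ->]; apply: is_poly_sub; [apply: poly_var | apply: poly_const].
move=> x; split=> [-> p [t ->]|h]; first by rewrite subrr.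
by apply/funext => t; apply/eqP; rewrite -subr_eq0; apply/eqP/(h (fun x => x t - a t)); exists t.
Qed.

Lemma irreducible_point (a : T -> C) : irreducible (@zclosed R T) (fun x => x = a).
Proof.
split; first by exists a.
by move=> A B _ _ /(_ a erefl)[h|h]; [left|right] => y ->.
Qed.

(** Finite unions kept as trees, so that components are handled by induction; [P] is asked of the
    irreducible leaves alone. *)
Inductive decomp (P : set -> Prop) : set -> Prop :=
| decomp_irr Y : zclosed Y -> irreducible (@zclosed R T) Y -> P Y -> decomp P Y
| decomp_empty Y : (forall x, ~ Y x) -> decomp P Y
| decomp_union A B Y : decomp P A -> decomp P B -> (forall x, Y x <-> A x \/ B x) -> decomp P Y.

Lemma decomp_zclosed P W : decomp P W -> zclosed W.
Proof.
elim=> [//|Y nY|A B Y _ cA _ cB YE].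
  exists (fun p => p = fun=> 1); split=> [p ->|x]; first exact: poly_const.
  split=> [/nY //|h]; by have /eqP := h _ erefl; rewrite oner_eq0.
by apply: zclosed_iff (zclosed_or cA cB) => x; rewrite YE.
Qed.

Lemma decomp_cover P W (c : set) : decomp P W -> irreducible (@zclosed R T) c ->
  (forall x, c x -> W x) ->
  exists Y, [/\ zclosed Y, irreducible (@zclosed R T) Y, P Y,
                forall x, c x -> Y x & forall x, Y x -> W x].
Proof.
elim=> [Y cY iY PY _ cW|Y nY [[x cx] _] /(_ x cx) /nY //|A B Y dA IHA dB IHB YE ic cW].
  by exists Y.
have [x cx||] := ic.2 A B (decomp_zclosed dA) (decomp_zclosed dB).
- by apply/YE/cW.
- by move=> /(IHA ic)[Z [h1 h2 h3 h4 h5]]; exists Z; split=> // x /h5 Ax; apply/YE; left.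
- by move=> /(IHB ic)[Z [h1 h2 h3 h4 h5]]; exists Z; split=> // x /h5 Ax; apply/YE; right.
Qed.

(** Noetherian induction: a closed set without decomposition is reducible, and one of its two proper
    closed parts is again without decomposition; iterating contradicts [zclosed_dcc]. *)
Lemma zclosed_decomp (W : set) : zclosed W -> decomp (fun=> True) W.
Proof.
move=> cW; apply: contrapT => nW.
pose bad := {V : set | zclosed V /\ ~ decomp (fun=> True) V}.
have /choice[nx Hnx] : forall V : bad, exists V' : bad,
    (forall x, sval V' x -> sval V x) /\ exists x, sval V x /\ ~ sval V' x.
  move=> [V [cV nV]] /=.
  have [x0 Vx0] : exists x, V x.
    by apply: contrapT => /forallNP h; apply: nV; apply: decomp_empty.
  have [A [B [cA cB VAB nA nB]]] : exists A B, [/\ zclosed A, zclosed B,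
      forall x, V x -> A x \/ B x, ~ forall x, V x -> A x & ~ forall x, V x -> B x].
    apply: contrapT => h; apply: nV; apply: decomp_irr => //; split; first by exists x0.
    move=> A B cA cB VAB; apply: contrapT => /not_orP[nA nB]; apply: h.
    by exists A, B.
  have step A' : zclosed A' -> (~ forall x, V x -> A' x) ->
      ~ decomp (fun=> True) (fun x => V x /\ A' x) ->
      exists V' : bad, (forall x, sval V' x -> V x) /\ exists x, V x /\ ~ sval V' x.
    move=> cA' /existsNP[x /not_implyP[Vx nA'x]] nd.
    exists (exist _ (fun x => V x /\ A' x) (conj (zclosed_and cV cA') nd)) => /=.
    by split=> [y []//|]; exists x; split=> // -[].
  case: (pselect (decomp (fun=> True) (fun x => V x /\ A x))) => [dA|]; last exact: step.
  case: (pselect (decomp (fun=> True) (fun x => V x /\ B x))) => [dB|]; last exact: step.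
  exfalso; apply: nV; apply: decomp_union dA dB _ => x; split=> [Vx|[[]//|[]//]].
  by case: (VAB x Vx); [left|right].
pose V k := iter k nx (exist _ W (conj cW nW)).
have [k Hk] := @zclosed_dcc R T (fun k => sval (V k)) (fun k => (svalP (V k)).1)
  (fun k => (Hnx (V k)).1).
by have [_ [x [Vx nVx]]] := Hnx (V k); apply: nVx; apply: Hk.
Qed.

(** The image of [Y] under [z] is Zariski dense. *)
Definition dominant (Q : Type) (z : Q -> (T -> C) -> C) (Y : set) : Prop :=
  forall q, is_poly q -> (forall x, Y x -> q (fun i => z i x) = 0) -> forall a, q a = 0.

(** [D] collects the components of [W] with dense image; the images of the others lie in a common
    hypersurface [q = 0]. *)
Lemma dominant_part (Q : Type) (z : Q -> (T -> C) -> C) (W : set) : zclosed W ->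
  exists D q, [/\ decomp (dominant z) D, forall x, D x -> W x, is_poly q,
     exists a, q a != 0 & forall x, W x -> D x \/ q (fun i => z i x) = 0].
Proof.
move=> /zclosed_decomp; elim=> [Y cY iY _|Y nY|A B Y _ IHA _ IHB YE].
- case: (pselect (dominant z Y)) => [dY|].
    exists Y, (fun=> 1); split=> //; first exact: decomp_irr.
    - exact: poly_const.
    - by exists (fun=> 0); rewrite oner_eq0.
    - by move=> x; left.
  move=> /existsNP[q /not_implyP[pq /not_implyP[q0 /existsNP[a /eqP qa]]]].
  exists (fun=> False), q; split=> //; first by apply: decomp_empty => x [].
    by exists a.
  by move=> x /q0; right.
- exists (fun=> False), (fun=> 1); split=> //; first by apply: decomp_empty => x [].
  + exact: poly_const.
  + by exists (fun=> 0); rewrite oner_eq0.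
  + by move=> x /nY.
have [D1 [q1 [d1 s1 p1 n1 c1]]] := IHA; have [D2 [q2 [d2 s2 p2 n2 c2]]] := IHB.
exists (fun x => D1 x \/ D2 x), (fun a => q1 a * q2 a); split.
- by apply: decomp_union d1 d2 _.
- by move=> x [/s1|/s2] h; apply/YE; [left|right].
- exact: poly_mul.
- exact: is_poly_mul_neq0.
- move=> x /YE[/c1[]|/c2[]] h; [by left; left| |by left; right|]; right; by rewrite h ?mul0r ?mulr0.
Qed.

End OneSpace.

(** Over generic values, [W] may be replaced by its components with dense image. Induction gives a
    chain where the last [z] equals a generic constant [v]; its top lies in one of these components,
    and is proper there because [z] is not constant on a set with dense image. *)
Lemma chain_exists (T : finType) n (W : (T -> C) -> Prop) (z : 'I_n -> (T -> C) -> C)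
    (g : ('I_n -> C) -> C) :
  zclosed W -> (forall i, is_poly (z i)) -> is_poly g -> (exists a, g a != 0) ->
  (forall a, g a != 0 -> exists2 x, W x & forall i, z i x = a i) ->
  irr_chain (@zclosed R T) W n.
Proof.
elim: n W z g => [|n IHn] W z g cW pz pg [a0 ga0] Hg.
  have [x Wx _] := Hg _ ga0; exists (fun _ y => y = x); split=> // k _.
  by split; [exact: zclosed_point | exact: irreducible_point | move=> y ->].
have [D [q [dD DW pq nq Wq]]] := dominant_part z cW.
(* Only the last coordinate of [a] gets fixed; the others witness that the restriction of [g * q] to
   this value is not zero. *)
have [a ga] := is_poly_mul_neq0 pg pq (ex_intro (fun a => g a != 0) a0 ga0) nq.
pose v := a ord_max.
pose ext (b : 'I_n -> C) (i : 'I_n.+1) := if unlift ord_max i is Some j then b j else v.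
have ext_lift b j : ext b (lift ord_max j) = b j by rewrite /ext liftK.
have ext_max b : ext b ord_max = v by rewrite /ext unlift_none.
have pext i : is_poly (fun b => ext b i).
  by rewrite /ext; case: (unlift _ _) => [j|]; [exact: poly_var | exact: poly_const].
have [|||||c [cP cS]] := IHn (fun x => D x /\ z ord_max x - v = 0) (fun j => z (lift ord_max j))
    (fun b => g (ext b) * q (ext b)).
- apply: zclosed_and; first exact: decomp_zclosed dD.
  by apply: zclosed_zero; apply: is_poly_sub => //; exact: poly_const.
- by move=> i.
- apply: poly_mul; first exact: (is_poly_comp (f := fun i b => ext b i) pg).
  exact: (is_poly_comp (f := fun i b => ext b i) pq).
- exists (fun j => a (lift ord_max j)); congr (_ != 0): ga.
  suff -> : ext (fun j => a (lift ord_max j)) = a by [].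
  by apply/funext => i; rewrite /ext; case: unliftP => [j ->|->].
- move=> b; rewrite mulf_eq0 negb_or => /andP[gb qb].
  have [x Wx zx] := Hg _ gb; exists x; last by move=> j; rewrite zx ext_lift.
  split; last by rewrite zx ext_max subrr.
  case: (Wq x Wx) => // /eqP; rewrite (_ : (fun i => z i x) = ext b) ?(negPf qb) //.
  by apply/funext.
have [_ icn cnW] := cP n (leqnn n).
have [Y [cY iY dY cnY YD]] := decomp_cover dD icn (fun x h => (cnW x h).1).
exists (fun k => if (k <= n)%N then c k else Y); split=> [k|k].
  move=> le1; have [->|le] : k = n.+1 \/ (k <= n)%N by lia.
    by rewrite ltnn; split=> // x /YD /DW.
  rewrite le; have [h1 h2 h3] := cP k le.
  by split=> // x /h3[/DW].
move=> le; have [->|lt] : k = n \/ (k < n)%N by lia.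
  2: by rewrite (ltnW lt) lt; apply: cS.
rewrite leqnn ltnn; split=> //; apply: contrapT => /forallNP nY.
have Yc y : Y y -> c n y by move=> Yy; apply: contrapT => ncy; apply: (nY y).
have pd : is_poly (fun b : 'I_n.+1 -> C => b ord_max - v).
  by apply: is_poly_sub; [exact: poly_var | exact: poly_const].
have := dY _ pd (fun x Yx => (cnW x (Yc x Yx)).2) (fun=> v + 1).
by move/eqP; rewrite addrAC subrr add0r oner_eq0.
Qed.

End Decomposition.

(** * Images and tangent directions of polynomial maps *)

Section ConstructibleImages.
Variable R : realType.
Local Notation C := (R[i]).

Definition env (I : finType) (y : I -> C) : seq C := [seq y i | i <- enum I].

Lemma is_poly_env (I : finType) k : is_poly (fun y : I -> C => (env y)`_k).
Proof.
case: (ltnP k #|I|) => [lt|le].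
  apply: is_poly_ext (poly_var _ (enum_val (Ordinal lt))) => y.
  rewrite /env (nth_map (enum_val (Ordinal lt))) -?cardE //.
  by congr y; apply: (enum_val_nth _ (Ordinal lt)).
apply: is_poly_ext (poly_const I 0) => y.
by rewrite nth_default // size_map -cardE.
Qed.

Lemma is_poly_eval (I : finType) (t : GRing.term C) :
  GRing.rterm t -> is_poly (fun y : I -> C => GRing.eval (env y) t).
Proof.
elim: t => //= [k _|c _|n _|t1 IH1 t2 IH2 /andP[/IH1 h1 /IH2 h2]|t IH /IH h
  |t IH n /IH h|t1 IH1 t2 IH2 /andP[/IH1 h1 /IH2 h2]|t IH n /IH h].
- exact: is_poly_env.
- exact: poly_const.
- exact: poly_const.
- exact: poly_add.
- exact: is_poly_opp.
- apply: is_poly_ext (poly_mul h (poly_const _ n%:R)) => y; by rewrite mulr_natr.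
- exact: poly_mul.
- exact: is_poly_exp.
Qed.

(** An equation holds identically or fails on a nonempty open set; Boolean combinations follow
    because such sets meet. *)
Lemma qf_generic (I : finType) (f : GRing.formula C) :
  GRing.qf_form f -> GRing.rformula f ->
  exists g b, [/\ is_poly g, exists y, g y != 0 &
    forall y : I -> C, g y != 0 -> GRing.qf_eval (env y) f = b].
Proof.
have one : [/\ is_poly (fun _ : I -> C => 1 : C) & exists y : I -> C, (1 : C) != 0].
  by split; [exact: poly_const | exists (fun=> 0); rewrite oner_eq0].
have bin (P1 P2 P : (I -> C) -> bool) (op : bool -> bool -> bool) :
    (forall y, P y = op (P1 y) (P2 y)) ->
    (exists g b, [/\ is_poly g, exists y, g y != 0 & forall y, g y != 0 -> P1 y = b]) ->
    (exists g b, [/\ is_poly g, exists y, g y != 0 & forall y, g y != 0 -> P2 y = b]) ->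
    exists g b, [/\ is_poly g, exists y, g y != 0 & forall y, g y != 0 -> P y = b].
  move=> PE [g1 [b1 [p1 n1 H1]]] [g2 [b2 [p2 n2 H2]]].
  exists (fun y => g1 y * g2 y), (op b1 b2); split.
  - exact: poly_mul.
  - exact: is_poly_mul_neq0.
  - by move=> y; rewrite mulf_eq0 negb_or => /andP[/H1 h1 /H2 h2]; rewrite PE h1 h2.
elim: f => //= [b _ _|t1 t2 _ /andP[r1 r2]|f1 IH1 f2 IH2 /andP[q1 q2] /andP[r1 r2]
  |f1 IH1 f2 IH2 /andP[q1 q2] /andP[r1 r2]|f1 IH1 f2 IH2 /andP[q1 q2] /andP[r1 r2]|f1 IH1 q1 r1].
- by exists (fun=> 1), b; split; case: one.
- have pd := is_poly_sub (is_poly_eval I r1) (is_poly_eval I r2).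
  case: (pselect (exists y : I -> C, GRing.eval (env y) t1 - GRing.eval (env y) t2 != 0)) => [h|].
    exists (fun y => GRing.eval (env y) t1 - GRing.eval (env y) t2), false; split=> // y.
    by rewrite subr_eq0 => /negPf.
  move=> /forallNP h; exists (fun=> 1), true; split; try by case: one.
  by move=> y _; have /negP := h y; rewrite negbK subr_eq0.
- exact: (bin _ _ _ andb) (IH1 q1 r1) (IH2 q2 r2).
- exact: (bin _ _ _ orb) (IH1 q1 r1) (IH2 q2 r2).
- exact: (bin _ _ _ implb) (IH1 q1 r1) (IH2 q2 r2).
- exact: (bin _ _ _ (fun b _ => ~~ b)) (IH1 q1 r1) (IH1 q1 r1).
Qed.

Lemma is_poly_term (U : finType) (v : U -> nat) (p : (U -> C) -> C) : is_poly p ->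
  exists t : GRing.term C, GRing.rterm t /\ forall e, GRing.eval e t = p (fun u => e`_(v u)).
Proof.
elim=> [c|u|p1 p2 _ [t1 [r1 h1]] _ [t2 [r2 h2]]|p1 p2 _ [t1 [r1 h1]] _ [t2 [r2 h2]]].
- by exists (GRing.Const c).
- by exists (GRing.Var _ (v u)).
- by exists (GRing.Add t1 t2); rewrite /= r1 r2; split=> // e; rewrite h1 h2.
- by exists (GRing.Mul t1 t2); rewrite /= r1 r2; split=> // e; rewrite h1 h2.
Qed.

Definition join_pt (I T : Type) (y : I -> C) (x : T -> C) (u : I + T) : C :=
  match u with inl i => y i | inr t => x t end.

(** A form of Chevalley's theorem: quantifier elimination over the algebraically closed field [C]
    turns the existence of [x] into a quantifier-free condition on [y], whose truth value is
    generically constant. *)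
Lemma image_dichotomy (I T E : finType) (F : E -> (I + T -> C) -> C) :
  (forall e, is_poly (F e)) ->
  exists g : (I -> C) -> C, [/\ is_poly g, exists y, g y != 0 &
    (forall y, g y != 0 -> exists x, forall e, F e (join_pt y x) = 0) \/
    (forall y, g y != 0 -> ~ exists x, forall e, F e (join_pt y x) = 0)].
Proof.
move=> pF.
pose v (u : I + T) : nat := match u with
  | inl i => enum_rank i | inr t => (#|I| + enum_rank t)%N end.
have /choice[t Ht] e := is_poly_term v (pF e).
pose body := \big[GRing.And/GRing.Bool true]_e GRing.Equal (t e) (GRing.Const 0).
have rbody : GRing.rformula body.
  rewrite /body; elim/big_ind: _ => //= [f1 f2 -> -> //|e _].
  by rewrite (Ht e).1.
have hbody env : GRing.holds env body <-> forall e, GRing.eval env (t e) = 0.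
  rewrite /body; split=> [h e|h].
    move: h (mem_index_enum e); elim: (index_enum E) => [//|e' s IHs].
    rewrite big_cons in_cons => -[h0 hs] /orP[/eqP -> //|]; exact: IHs.
  by elim: (index_enum E) => [|e s IHs]; [by rewrite big_nil | by rewrite big_cons; split; first exact: h].
pose f := foldr (@GRing.Exists C) body (iota #|I| #|T|).
have rf : GRing.rformula f by rewrite /f; elim: (iota _ _).
have fP y : GRing.holds (env y) f <-> exists x, forall e, F e (join_pt y x) = 0.
  rewrite -GRing.foldExistsP; split=> [[e' se' /hbody h]|[x h]].
    exists (fun t => e'`_(#|I| + enum_rank t)) => e; rewrite -[RHS](h e) (Ht e).2.
    congr (F e); apply/funext => -[i|t'] //=.
    rewrite -se'.
      by rewrite /env (nth_map i) ?nth_enum_rank // -cardE.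
    by rewrite !inE mem_iota leqNgt ltn_ord.
  (* The two environments must agree at all unquantified variables, also beyond both lists, where
     each gives 0. *)
  exists (env y ++ env x).
    move=> i; rewrite !inE mem_iota negb_and -!leqNgt -!ltnNge => hi.
    rewrite nth_cat; rewrite size_map -cardE; case: ltnP => // le.
    move: hi; rewrite ltnNge le /= => hi.
    by rewrite !nth_default // size_map -cardE // leq_subRL.
  apply/hbody => e; rewrite (Ht e).2 -[RHS](h e); congr (F e); apply/funext => -[i|t'] /=.
    by rewrite nth_cat size_map -cardE ltn_ord /env (nth_map i) ?nth_enum_rank // -cardE.
  rewrite nth_cat size_map -cardE ltnNge leq_addr addKn /=.
  by rewrite /env (nth_map t') ?nth_enum_rank // -cardE.
have cC : GRing.closed_field_axiom C by exact: solve_monicpoly.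
have wf := @ClosedFieldQE.wf_ex_elim C; have hq := ClosedFieldQE.holds_ex_elim cC.
have /andP[qq rq] := GRing.quantifier_elim_wf wf rf.
have [g [b [pg ng Hg]]] := qf_generic I qq rq.
exists g; split=> //; case: b Hg => Hg; [left|right] => y /Hg.
  by move=> /(GRing.quantifier_elim_rformP wf hq _ rf) /fP.
move=> h /fP /(GRing.quantifier_elim_rformP wf hq _ rf); by rewrite h.
Qed.

(* A curve p + t w + O(t^2) detects the lowest homogeneous part of G at p. *)
Lemma vanish_along_curves (I : finType) (G : (I -> C) -> C) (p : I -> C) :
  is_poly G ->
  (forall w : I -> C, exists q : I -> {poly C}, forall t,
     G (fun i => p i + t * (w i + t * (q i).[t])) = 0) ->
  forall y, G y = 0.
Proof.
move=> pG H y0; apply/eqP; apply: contrapT => /negP Gy0.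
have pG1 : is_poly (fun u => G (fun i => p i + u i)).
  apply: (is_poly_comp (f := fun i u => p i + u i) pG) => i.
  by apply: poly_add; [exact: poly_const | exact: poly_var].
have [s [c [us cs Gs]]] := is_poly_expand pG1.
have [m1 m1s] : exists n, n \in s.
  case: s {us cs} Gs => [|n s] Gs; last by exists n; rewrite mem_head.
  have := Gs (fun i => y0 i - p i); rewrite big_nil => E; case/eqP: Gy0; rewrite -[RHS]E.
  by congr G; apply/funext => i; rewrite addrC subrK.
pose deg (m : {ffun I -> nat}) := (\sum_i m i)%N.
have exP : exists k, has (fun m => deg m == k) s by exists (deg m1); apply/hasP; exists m1.
have [k /hasP[m0 m0s /eqP m0k] kmin] := ex_minnP exP.
have lek m : m \in s -> (k <= deg m)%N by move=> ms; apply: kmin; apply/hasP; exists m.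
(* [w] is a direction in which the lowest homogeneous part, of degree [k], does not vanish. *)
have [|||w] := @meval_lin_indep R _ [seq m <- s | deg m == k] c m0.
- exact: filter_uniq.
- by rewrite mem_filter m0k eqxx.
- exact: cs.
have [q Hq] := H w; rewrite big_filter; apply/negP; rewrite negbK.
(* Along the curve [G] is ['X^k * P], and [P] at 0 is the lowest homogeneous part at [w]. *)
pose P : {poly C} := \sum_(m <- s) c m *: ('X^(deg m - k) * \prod_i ((w i)%:P + 'X * q i) ^+ m i).
have PE t : P.[t] = \sum_(m <- s) c m * (t ^+ (deg m - k) * meval m (fun i => w i + t * (q i).[t])).
  rewrite horner_sum; apply: eq_bigr => m _; rewrite hornerZ hornerM hornerXn horner_prod.
  by congr (_ * (_ * _)); apply: eq_bigr => i _; rewrite horner_exp !hornerE.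
have P0 : 'X^k * P = 0.
  apply/eqP; apply: contrapT => /negP /poly_nonroot[t /negP]; apply; apply/eqP.
  rewrite hornerM hornerXn PE -[RHS](Hq t) Gs mulr_sumr.
  rewrite big_seq [RHS]big_seq; apply: eq_bigr => m ms.
  by rewrite meval_scale -/(deg m) -{2}(subnK (lek m ms)) exprD; ring.
have {P0} : P = 0.
  by move/eqP: P0; rewrite mulf_eq0 -size_poly_eq0 size_polyXn => /orP[//|/eqP].
move/(congr1 (fun P : {poly C} => P.[0])); rewrite horner0 PE => E.
apply/eqP; rewrite -[RHS]E.
rewrite big_mkcond /= big_seq [RHS]big_seq; apply: eq_bigr => m ms.
rewrite expr0n subn_eq0 eqn_leq lek // andbT; case: ifP => _; last by rewrite mul0r mulr0.
by rewrite mul1r; congr (_ * meval m _); apply/funext => i; rewrite mul0r addr0.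
Qed.

End ConstructibleImages.

(** * Surjectivity of the linearized equations *)

Section LinearAlgebra.
Variable F : fieldType.

(** A surjective [L] has rank [m]; in its Gaussian decomposition, the rows of the invertible
    [row_ebase L] after the first [m] complete it. *)
Lemma complete_surjection (m n : nat) (L : 'M[F]_(m, m + n)) :
  (forall w : 'cV_m, exists x, L *m x = w) ->
  exists l : 'M[F]_(n, m + n), forall (w : 'cV_m) (a : 'cV_n),
    exists x, L *m x = w /\ l *m x = a.
Proof.
move=> surj; have fL : row_free L.
  apply: inj_row_free => v vL; apply/rowP => i; rewrite mxE.
  have [x Lx] := surj (delta_mx i 0).
  have := congr1 (mulmx v) Lx; rewrite mulmxA vL mul0mx => /matrixP/(_ 0 0).
  rewrite mxE => ->; rewrite mxE (bigD1 i) //= !mxE !eqxx mulr1 big1 ?addr0 // => k nk.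
  by rewrite !mxE (negPf nk) mulr0.
exists (dsubmx (row_ebase L)) => w a.
exists (invmx (row_ebase L) *m col_mx (invmx (col_ebase L) *m w) a); split.
  rewrite -{1}(mulmx_ebase L) -!mulmxA (mulKVmx (row_ebase_unit L)).
  have -> : pid_mx (\rank L) = row_mx 1%:M 0 :> 'M[F]_(m, m + n).
    by rewrite (eqP fL) pid_mx_row.
  by rewrite mul_row_col mul1mx mul0mx addr0 mulKVmx ?col_ebase_unit.
by rewrite mul_dsub_mx mulKVmx ?row_ebase_unit // col_mxKd.
Qed.

Definition selmx (r d : nat) (f : nat -> nat) : 'M[F]_(r, d) :=
  \matrix_(i, c) ((i : nat) == f c)%:R.

Lemma mulmx_sel (d1 r d2 : nat) (y : nat -> nat -> F) f (a : 'I_d1) (c : 'I_d2) :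
  (\matrix_(a < d1, i < r) y a i *m selmx r d2 f) a c = if (f c < r)%N then y a (f c) else 0.
Proof.
rewrite mxE; case: ifP => [lt|ge].
  rewrite (bigD1 (Ordinal lt)) //= !mxE eqxx mulr1 big1 ?addr0 // => i.
  by rewrite -val_eqE !mxE /= => /negPf ->; rewrite mulr0.
rewrite big1 // => i _; rewrite !mxE; case: eqP => [E|]; last by rewrite mulr0.
by move: ge; rewrite -E ltn_ord.
Qed.

Definition cdiff K (i j : 'I_K.+1) : nat := ((j - i)%R : 'I_K.+1).

(* Solvability of y_(i,a)[al(c)] + x_(j,c)[be(a)] = t_(i,j)(a,c), where al and be only depend
   on the difference of j and i modulo K, and a label >= r stands for no unknown. *)
Lemma sel_solvable (K d r : nat) (al be : nat -> nat -> nat) :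
  (forall t : 'I_K.+1 -> 'I_K.+1 -> nat -> nat -> F,
   exists (y : 'I_K.+1 -> nat -> nat -> F) (x : 'I_K.+1 -> nat -> nat -> F),
   forall (i j : 'I_K.+1) a c, i != j -> (a < d)%N -> (c < d)%N ->
    (if (al (cdiff i j) c < r)%N then y i a (al (cdiff i j) c) else 0) +
    (if (be (cdiff i j) a < r)%N then x j (be (cdiff i j) a) c else 0) = t i j a c) ->
  exists (A : 'I_K.+1 -> 'I_K.+1 -> 'M[F]_(r, d)) (B : 'I_K.+1 -> 'I_K.+1 -> 'M[F]_(d, r)),
  forall T : 'I_K.+1 -> 'I_K.+1 -> 'M[F]_d,
  exists (Y : 'I_K.+1 -> 'M[F]_(d, r)) (X : 'I_K.+1 -> 'M[F]_(r, d)),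
  forall i j, i != j -> Y i *m A i j + B i j *m X j = T i j.
Proof.
move=> H; exists (fun i j : 'I_K.+1 => selmx r d (al (cdiff i j))).
exists (fun i j : 'I_K.+1 => (selmx r d (be (cdiff i j)))^T) => T.
pose t i j a c := if insub a is Some a' then if insub c is Some c' then T i j a' c' else 0 else 0.
have [y [x Hyx]] := H t.
exists (fun i => \matrix_(a, k) y i a k), (fun j => (\matrix_(c < d, k < r) x j k c)^T).
move=> i j ij; apply/matrixP => a c; rewrite mxE -trmx_mul [X in _ + X]mxE.
rewrite mulmx_sel (@mulmx_sel _ _ _ (fun c k => x j k c)) Hyx //.
by rewrite /t !valK.
Qed.

Lemma ord_sub_gt0 K (i j : 'I_K.+1) : i != j -> (0 < cdiff i j)%N.
Proof.
rewrite lt0n eq_sym; apply: contraNneq => h.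
by rewrite -subr_eq0 -(inj_eq val_inj); apply/eqP.
Qed.

Lemma sub_inordK K (i j : 'I_K.+1) : j - inord (cdiff i j) = i.
Proof. by rewrite /cdiff inord_val opprB addrC subrK. Qed.

Lemma add_inordK K (i j : 'I_K.+1) : i + inord (cdiff i j) = j.
Proof. by rewrite /cdiff inord_val addrC subrK. Qed.

(* Odd number of users 2m+1: Y serves the differences 1..m, X the differences m+1..2m. *)
Lemma blocks_odd (m d r : nat) : (m * d <= r)%N ->
  exists (A : 'I_(m.*2).+1 -> 'I_(m.*2).+1 -> 'M[F]_(r, d))
         (B : 'I_(m.*2).+1 -> 'I_(m.*2).+1 -> 'M[F]_(d, r)),
  forall T : 'I_(m.*2).+1 -> 'I_(m.*2).+1 -> 'M[F]_d,
  exists (Y : 'I_(m.*2).+1 -> 'M[F]_(d, r)) (X : 'I_(m.*2).+1 -> 'M[F]_(r, d)),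
  forall i j, i != j -> Y i *m A i j + B i j *m X j = T i j.
Proof.
move=> hr; apply: (@sel_solvable _ _ _
  (fun D c => if (D <= m)%N then (D.-1 * d + c)%N else r)
  (fun D a => if (D <= m)%N then r else ((D - m.+1) * d + a)%N)) => t.
(* A label encodes a difference and a column (for [Y]) or row (for [X]) below [d], recovered by
   division. *)
exists (fun (i : 'I_(m.*2).+1) a k => t i (i + inord (k %/ d).+1) a (k %% d)%N).
exists (fun (j : 'I_(m.*2).+1) k c => t (j - inord (k %/ d + m.+1)) j (k %% d)%N c).
move=> i j a c ij ad cd; have D0 := ord_sub_gt0 ij.
have DE := sub_inordK i j; have DE' := add_inordK i j.
have ltD : ((cdiff i j) < (m.*2).+1)%N by exact: ltn_ord.
move: DE DE' D0 ltD; move: (cdiff i j) => D DE DE' D0 ltD.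
have dp : (0 < d)%N by apply: leq_ltn_trans ad.
case: (leqP D m) => hD; rewrite ltnn.
  have -> : (D.-1 * d + c < r)%N by nia.
  by rewrite addr0 divnMDl // divn_small // addn0 prednK // DE' modnMDl modn_small.
have -> : ((D - m.+1) * d + a < r)%N by nia.
by rewrite add0r divnMDl // divn_small // addn0 subnK // DE modnMDl modn_small.
Qed.

(* Even number of users 2m+2: Y serves the differences 1..m, X the differences m+3..2m+1, and
   the blocks with difference m+1 and m+2 are split into halves of sizes e' and e; the unknowns
   of X serving the first e rows at difference m+1 also serve the last e rows at m+2. *)
Lemma blocks_even (m d r : nat) : (0 < m)%N -> (m * d + uphalf d <= r)%N ->
  exists (A : 'I_(m.*2).+2 -> 'I_(m.*2).+2 -> 'M[F]_(r, d))
         (B : 'I_(m.*2).+2 -> 'I_(m.*2).+2 -> 'M[F]_(d, r)),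
  forall T : 'I_(m.*2).+2 -> 'I_(m.*2).+2 -> 'M[F]_d,
  exists (Y : 'I_(m.*2).+2 -> 'M[F]_(d, r)) (X : 'I_(m.*2).+2 -> 'M[F]_(r, d)),
  forall i j, i != j -> Y i *m A i j + B i j *m X j = T i j.
Proof.
move=> mp hr; pose e := d./2; pose e' := uphalf d.
have ee : (e + e' = d)%N by rewrite /e /e' uphalf_half addnCA addnn odd_double_half.
have le_ee : (e <= e')%N by rewrite /e /e' uphalf_half leq_addl.
have le_e1 : (e' <= e.+1)%N by rewrite /e /e' uphalf_half; case: odd.
rewrite -/e' in hr; clearbody e e'.
apply: (@sel_solvable _ _ _
  (fun D c => if (D <= m)%N then (D.-1 * d + c)%N else
     if D == m.+1 then (if (c < e')%N then (m * d + c)%N else r) else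
     if D == m.+2 then (if (e' <= c)%N then (m * d + (c - e'))%N else r) else r)
  (fun D a => if (D <= m)%N then r else
     if D == m.+1 then (m.-1 * d + a)%N else
     if D == m.+2 then (if (a < e')%N then (m * d + a)%N else (m.-1 * d + (a - e'))%N) else
     ((D - m.+3) * d + a)%N)) => t.
pose I := 'I_(m.*2).+2; pose u : I := inord 1.
(* [x] is solved from the equations at difference [m.+1], and from those at [m.+2] in rows below
   [e']. In the remaining rows [a >= e'] at [m.+2] the unknown of [x] was already used at [m.+1] in
   row [a - e']. After substitution, columns below [e'] determine [y] on rows below [e], and the
   other columns determine it on rows from [e'] on; a row [e <= a < e'] may take any value. *)
pose y (i : I) a k : F := if (k < m * d)%N then t i (i + inord (k %/ d).+1) a (k %% d)%N else
  let z := (k - m * d)%N in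
  if (a < e)%N then t i (i + inord m.+1) a z - t (i - u) (i + inord m.+1) (e' + a)%N z else
  t i (i + inord m.+2) a (e' + z)%N - t (i + u) (i + inord m.+2) (a - e')%N (e' + z)%N.
pose x (j : I) k c : F := if (k < m.-1 * d)%N then t (j - inord (k %/ d + m.+3)) j (k %% d)%N c else
  if (k < m * d)%N then let a := (k - m.-1 * d)%N in let i := j - inord m.+1 in
     t i j a c - (if (c < e')%N then y i a (m * d + c)%N else 0) else
  let a := (k - m * d)%N in let i := j - inord m.+2 in
     t i j a c - (if (e' <= c)%N then y i a (m * d + (c - e'))%N else 0).
exists y, x => i j a c ij ad cd.
have D0 := ord_sub_gt0 ij.
have DE := sub_inordK i j; have DE' := add_inordK i j.
have ltD : (cdiff i j < (m.*2).+2)%N by exact: ltn_ord.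
have uE : inord m.+2 = inord m.+1 + u :> I.
  by apply: val_inj; rewrite /= !inordK ?modn_small; lia.
move: DE DE' D0 ltD; move: (cdiff i j) => D DE DE' D0 ltD.
have dp : (0 < d)%N by apply: leq_ltn_trans ad.
have yE i' a' z : y i' a' (m * d + z)%N =
   if (a' < e)%N then t i' (i' + inord m.+1) a' z - t (i' - u) (i' + inord m.+1) (e' + a')%N z else
   t i' (i' + inord m.+2) a' (e' + z)%N - t (i' + u) (i' + inord m.+2) (a' - e')%N (e' + z)%N.
  by rewrite /y ltnNge leq_addr /= addKn.
have mE : (m.-1 * d + d = m * d)%N by case: (m) mp => // m' _; rewrite mulSn addnC.
case: (leqP D m) => hD.
  rewrite ltnn; have lt : (D.-1 * d + c < m * d)%N by nia.
  have -> : (D.-1 * d + c < r)%N by lia.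
  by rewrite addr0 /y lt divnMDl // divn_small // addn0 prednK // DE' modnMDl modn_small.
have [D1|D1] := eqVneq D m.+1.
  have hb : (m.-1 * d + a < m * d)%N by lia.
  have -> : (m.-1 * d + a < r)%N by lia.
  have hb1 : (m.-1 * d + a < m.-1 * d)%N = false by lia.
  rewrite /x hb1 hb addKn -D1 DE.
  case: (ltnP c e') => hc; last by rewrite ltnn; ring.
  have -> : (m * d + c < r)%N by lia.
  by ring.
have [D2|D2] := eqVneq D m.+2.
  have iE : j - inord m.+2 = i by rewrite -D2.
  have jE : i + inord m.+2 = j by rewrite -D2.
  case: (ltnP a e') => ha /=.
    have -> : (m * d + a < r)%N by lia.
    have hb1 : (m * d + a < m.-1 * d)%N = false by lia.
    have hb2 : (m * d + a < m * d)%N = false by lia.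
    rewrite /x hb1 hb2 addKn iE.
    case: (leqP e' c) => hc; last by rewrite ltnn; ring.
    have -> : (m * d + (c - e') < r)%N by lia.
    by ring.
  have ha' : (a - e' < e)%N by lia.
  have -> : (m.-1 * d + (a - e') < r)%N by lia.
  have hb : (m.-1 * d + (a - e') < m * d)%N by lia.
  have iE2 : j - inord m.+1 = i + u by rewrite -iE uE; ring.
  have jE2 : i + u + inord m.+1 = j by rewrite -iE2 subrK.
  have hb1 : (m.-1 * d + (a - e') < m.-1 * d)%N = false by lia.
  rewrite /x hb1 hb addKn iE2; case: (leqP e' c) => hc; last first.
    by rewrite ltnn yE jE2 ha' addrK subnKC //; ring.
  have -> : (m * d + (c - e') < r)%N by lia.
  have aN : (a < e)%N = false by lia.
  by rewrite yE jE aN subnKC //; ring.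
rewrite ltnn add0r; have hD3 : (m.+3 <= D)%N by lia.
have lt : ((D - m.+3) * d + a < m.-1 * d)%N by nia.
have -> : ((D - m.+3) * d + a < r)%N by lia.
by rewrite /x lt divnMDl // divn_small // addn0 subnK // DE modnMDl modn_small.
Qed.

(** For [2 * m + 2] users, halving [(2 * m + 1) * d <= 2 * r] leaves [m * d] plus the larger half of
    [d], as [blocks_even] requires; [3 <= K] gives [0 < m] there. *)
Lemma blocks_surjective (K d r : nat) : (3 <= K)%N -> (K.-1 * d <= r.*2)%N ->
  exists (A : 'I_K -> 'I_K -> 'M[F]_(r, d)) (B : 'I_K -> 'I_K -> 'M[F]_(d, r)),
  forall T : 'I_K -> 'I_K -> 'M[F]_d,
  exists (Y : 'I_K -> 'M[F]_(d, r)) (X : 'I_K -> 'M[F]_(r, d)),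
  forall i j, i != j -> Y i *m A i j + B i j *m X j = T i j.
Proof.
move=> K3; have [m Km] : exists m, K = (m.*2).+1 \/ K = (m.*2).+2.
  exists (K.-1)./2; have := odd_double_half K.-1; case: odd => /= H; [right|left]; lia.
case: Km K3 => -> K3 hr; first by apply: blocks_odd; lia.
apply: blocks_even; first lia.
by have := odd_double_half d; rewrite uphalf_half; case: odd => /= H; nia.
Qed.

End LinearAlgebra.

(** * Charts of the product of Grassmannians *)

Lemma extend_injection (d r : nat) (f : 'I_d -> 'I_(d + r)) :
  injective f -> exists s : 'S_(d + r), forall i, s (lshift r i) = f i.
Proof.
move=> finj; pose A := ~: [set f i | i in 'I_d].
have cA : #|A| = r.
  by have := cardsC [set f i | i in 'I_d]; rewrite card_imset // !card_ord => /addnI.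
pose g (k : 'I_(d + r)) := match split k with
  | inl i => f i | inr j => enum_val (cast_ord (esym cA) j) end.
have ginj : injective g.
  move=> k1 k2; rewrite /g.
  have nA i j : f i <> enum_val (cast_ord (esym cA) j).
    by move=> E; have := enum_valP (cast_ord (esym cA) j); rewrite -E !inE imset_f.
  rewrite -[k1]splitK -[k2]splitK; case: (split k1) => [i1|j1]; case: (split k2) => [i2|j2];
    rewrite !unsplitK.
  - by move=> /finj ->.
  - by move=> /nA.
  - by move=> /esym /nA.
  - by move=> /enum_val_inj /cast_ord_inj ->.
exists (perm ginj) => i; rewrite permE /g.
by rewrite (_ : lshift r i = unsplit (inl i)) ?unsplitK.
Qed.

Lemma pivot_columns (F : fieldType) (d r : nat) (M : 'M[F]_(d, d + r)) :
  row_free M -> exists s : 'S_(d + r), lsubmx (col_perm s M) \in unitmx.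
Proof.
move=> fM; have fT : row_full M^T by rewrite /row_full mxrank_tr.
have [s Hs] := @extend_injection d r (fullrankfun fT) (@fullrankfun_inj _ _ _ _ fT).
exists s; rewrite -unitmx_tr.
suff -> : (lsubmx (col_perm s M))^T = rowsub (fullrankfun fT) M^T by apply: fullrowsub_unit.
by apply/matrixP => a c; rewrite !mxE Hs.
Qed.

Section Charts.
Variable R : realType.
Local Notation C := (R[i]).
Variables K d r : nat.
Local Notation N := (d + r)%N.
Local Notation stiefel := (stiefel_idx K d N).
Local Notation chart_idx := (bool * 'I_K * 'I_d * 'I_r)%type.
Local Notation atlas := {ffun bool * 'I_K -> 'S_(d + r)}.

Definition pt (s : strategy R K d N) (b : bool) (i : 'I_K) : 'M[C]_N :=
  val (if b then s.2 i else s.1 i).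

Lemma stiefel_repP (y : stiefel -> C) s :
  stiefel_rep y s <-> forall b i, (stmat y b i == pt s b i)%MS.
Proof.
split=> [h [] i|h i]; [exact: (h i).2 | exact: (h i).1 |].
by split; [exact: (h false i) | exact: (h true i)].
Qed.

Lemma pt_genmx s b i : <<pt s b i>>%MS = pt s b i.
Proof. by apply/eqP; case/andP: (valP (if b then s.2 i else s.1 i)). Qed.

Lemma rank_pt s b i : \rank (pt s b i) = d.
Proof. by apply/eqP; case/andP: (valP (if b then s.2 i else s.1 i)). Qed.

Lemma strategy_eq s s' : (forall b i, pt s b i = pt s' b i) -> s = s'.
Proof.
case: s s' => [U V] [U' V'] h; congr pair; apply/funext => i; apply: val_inj.
  exact: (h false i).
exact: (h true i).
Qed.

Lemma stiefel_rep_pt (y : stiefel -> C) s b i :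
  stiefel_rep y s -> pt s b i = <<stmat y b i>>%MS.
Proof. by move=> /stiefel_repP h; rewrite -pt_genmx; apply/esym/genmxP. Qed.

Lemma stiefel_rep_free (y : stiefel -> C) s b i : stiefel_rep y s -> row_free (stmat y b i).
Proof.
by move=> /stiefel_repP/(_ b i)/eqmxP E; rewrite /row_free E rank_pt.
Qed.

Lemma grass_ofP (M : 'M[C]_(d, N)) : \rank M == d ->
  (<<<<M>>>>%MS == <<M>>%MS) && (\rank <<M>> == d).
Proof. by move=> h; rewrite genmx_id eqxx genmxE. Qed.

Definition grass_of (M : 'M[C]_(d, N)) (h : \rank M == d) : Grass R d N :=
  exist _ <<M>>%MS (grass_ofP h).

Definition xmx (x : chart_idx -> C) b i : 'M[C]_(d, r) := \matrix_(a, c) x (b, i, a, c).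

Definition rep (s : atlas) (x : chart_idx -> C) b i : 'M[C]_(d, N) :=
  col_perm (s (b, i))^-1 (row_mx 1%:M (xmx x b i)).

Lemma rank_rep s x b i : \rank (rep s x b i) == d.
Proof.
apply/row_freeP; exists (perm_mx (s (b, i))^-1 *m col_mx 1%:M 0).
rewrite /rep col_permE invgK -mulmxA (mulmxA _ _ (col_mx _ _)) -perm_mxM mulgV perm_mx1 mul1mx.
by rewrite mul_row_col mul1mx mulmx0 addr0.
Qed.

Definition sch (s : atlas) (x : chart_idx -> C) : strategy R K d N :=
  (fun i => grass_of (rank_rep s x false i), fun i => grass_of (rank_rep s x true i)).

Lemma pt_sch s x b i : pt (sch s x) b i = <<rep s x b i>>%MS.
Proof. by case: b. Qed.

Definition rep_pt (s : atlas) (x : chart_idx -> C) : stiefel -> C :=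
  fun u => let: (b, i, a, c) := u in rep s x b i a c.

Lemma stmat_rep_pt s x b i : stmat (rep_pt s x) b i = rep s x b i.
Proof. by apply/matrixP => a c; rewrite mxE. Qed.

Lemma stiefel_rep_sch s x : stiefel_rep (rep_pt s x) (sch s x).
Proof.
by apply/stiefel_repP => b i; rewrite stmat_rep_pt pt_sch; apply/eqmxP/eqmx_sym/genmxE.
Qed.

Definition loc (s : atlas) (y : stiefel -> C) b i := col_perm (s (b, i)) (stmat y b i).

(** Nonzero exactly at the bases of the strategies in the chart [sch s]. *)
Definition den (s : atlas) (y : stiefel -> C) : C :=
  \prod_(u : bool * 'I_K) \det (lsubmx (loc s y u.1 u.2)).

Definition crd (s : atlas) (y : stiefel -> C) : chart_idx -> C := fun u =>
  let: (b, i, a, c) := u in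
  (invmx (lsubmx (loc s y b i)) *m rsubmx (loc s y b i)) a c.

Lemma den_unit s y b i : den s y != 0 -> lsubmx (loc s y b i) \in unitmx.
Proof.
move=> h; rewrite unitmxE unitfE; apply: contraNneq h => E.
by rewrite /den (bigD1 (b, i)) //= E mul0r.
Qed.

Lemma crd_rep s y sg : stiefel_rep y sg -> den s y != 0 -> sg = sch s (crd s y).
Proof.
move=> hy hd; apply: strategy_eq => b i; rewrite pt_sch (stiefel_rep_pt _ _ hy).
apply/genmxP; have U := den_unit b i hd.
have E : loc s y b i = lsubmx (loc s y b i) *m row_mx 1%:M (xmx (crd s y) b i).
  rewrite mul_mx_row mulmx1 (_ : xmx _ b i = invmx (lsubmx (loc s y b i)) *m rsubmx (loc s y b i)).
    by rewrite mulKVmx // hsubmxK.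
  by apply/matrixP => a c; rewrite mxE.
have -> : stmat y b i = lsubmx (loc s y b i) *m rep s (crd s y) b i.
  rewrite /rep col_permE mulmxA -E /loc col_permE -mulmxA -perm_mxM invgK mulVg perm_mx1.
  by rewrite mulmx1.
by apply/eqmxP/eqmxMfull; rewrite row_full_unit.
Qed.

Lemma crd_sch s y x : stiefel_rep y (sch s x) -> den s y != 0 /\ crd s y = x.
Proof.
move=> hy; have fy b i := stiefel_rep_free b i hy.
have E b i : exists2 G, G \in unitmx & loc s y b i = row_mx G (G *m xmx x b i).
  have /stiefel_repP/(_ b i) := hy; rewrite pt_sch => /eqmxP h.
  have /submxP[G HG] : (stmat y b i <= rep s x b i)%MS by rewrite h genmxE.
  exists G.
    rewrite -row_free_unit; have := fy b i; rewrite /row_free HG => /eqP E.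
    by rewrite eqn_leq rank_leq_row -{1}E mxrankM_maxl.
  rewrite /loc HG col_permE /rep col_permE -!mulmxA -perm_mxM invgK mulgV perm_mx1 mulmx1.
  by rewrite mul_mx_row mulmx1.
split.
  apply/prodf_neq0 => -[b i] _ /=; have [G uG ->] := E b i.
  by rewrite row_mxKl -unitfE -unitmxE.
apply/funext => -[[[b i] a] c]; rewrite /crd; have [G uG ->] := E b i.
by rewrite row_mxKl row_mxKr mulKmx // mxE.
Qed.

Lemma sch_surj sg : exists s x, sg = sch s x.
Proof.
have /choice[M HM] (u : bool * 'I_K) : exists M : 'M[C]_(d, N), (M == pt sg u.1 u.2)%MS.
  have := row_base (pt sg u.1 u.2); have := eq_row_base (pt sg u.1 u.2).
  move: (row_base _); rewrite rank_pt => M h _; by exists M; apply/eqmxP.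
pose y : stiefel -> C := fun u => let: (b, i, a, c) := u in M (b, i) a c.
have hy : stiefel_rep y sg.
  apply/stiefel_repP => b i; rewrite (_ : stmat y b i = M (b, i)); first exact: (HM (b, i)).
  by apply/matrixP => a c; rewrite mxE.
have /choice[s Hs] (u : bool * 'I_K) := pivot_columns (stiefel_rep_free u.1 u.2 hy).
exists (finfun s), (crd (finfun s) y); apply: crd_rep => //.
apply/prodf_neq0 => -[b i] _ /=; rewrite -unitfE -unitmxE /loc ffunE; exact: (Hs (b, i)).
Qed.

Lemma is_poly_entry (b : bool) (i : 'I_K) (a : 'I_d) (c : 'I_N) :
  is_poly (fun y : stiefel -> C => stmat y b i a c).
Proof. by apply: is_poly_ext (poly_var _ (b, i, a, c)) => y; rewrite mxE. Qed.

Lemma is_poly_loc s b i a c : is_poly (fun y : stiefel -> C => loc s y b i a c).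
Proof.
by apply: is_poly_ext (is_poly_entry b i a (s (b, i) c)) => y; rewrite /loc [RHS]mxE.
Qed.

Lemma is_poly_lsub_loc s b i a c : is_poly (fun y : stiefel -> C => lsubmx (loc s y b i) a c).
Proof. by apply: is_poly_ext (is_poly_loc s b i a (lshift r c)) => y; rewrite [RHS]mxE. Qed.

Lemma is_poly_den s : is_poly (den s).
Proof. by apply: is_poly_prod => u _; apply: is_poly_det => a c; apply: is_poly_lsub_loc. Qed.

Lemma is_poly_rep s b i a c : is_poly (fun x : chart_idx -> C => rep s x b i a c).
Proof.
apply: (@is_poly_ext _ _ (fun x => row_mx 1%:M (xmx x b i) a ((s (b, i))^-1%g c))) => [x|].
  by rewrite /rep [RHS]mxE.
case: (splitP ((s (b, i))^-1%g c)) => k Hk.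
  apply: is_poly_ext (poly_const _ ((a == k)%:R)) => x.
  by rewrite (_ : (s (b, i))^-1%g c = lshift r k) ?row_mxEl ?mxE //; apply: val_inj.
apply: is_poly_ext (poly_var _ (b, i, a, k)) => x.
by rewrite (_ : (s (b, i))^-1%g c = rshift d k) ?row_mxEr ?mxE //; apply: val_inj.
Qed.

(** By Cramer's rule the chart coordinates are polynomials divided by minors, all of which divide
    [den s]. *)
Lemma clear_denominators s (f : (chart_idx -> C) -> C) : is_poly f ->
  exists n F, is_poly F /\ forall y, den s y != 0 -> F y = den s y ^+ n * f (crd s y).
Proof.
elim=> [c|[[[b i] a] c]|p1 p2 _ [n1 [F1 [P1 H1]]] _ [n2 [F2 [P2 H2]]]
  |p1 p2 _ [n1 [F1 [P1 H1]]] _ [n2 [F2 [P2 H2]]]].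
- by exists 0%N, (fun=> c); split=> [|y _]; [exact: poly_const | rewrite mul1r].
- exists 1%N, (fun y => \prod_(u | u != (b, i)) \det (lsubmx (loc s y u.1 u.2)) *
     (\adj (lsubmx (loc s y b i)) *m rsubmx (loc s y b i)) a c); split.
    apply: poly_mul.
      by apply: is_poly_prod => u _; apply: is_poly_det => a' c'; apply: is_poly_lsub_loc.
    apply: is_poly_mulmx => [a' c'|a' c'].
      apply: (@is_poly_ext _ _ (fun y => cofactor (lsubmx (loc s y b i)) c' a')) => [y|].
        by rewrite mxE.
      apply: poly_mul; first exact: poly_const.
      apply: is_poly_det => a'' c''.
      apply: is_poly_ext (is_poly_lsub_loc s b i (lift c' a'') (lift a' c'')) => y.
      by rewrite [RHS]mxE [RHS]mxE.
    by apply: is_poly_ext (is_poly_loc s b i a' (rshift d c')) => y; rewrite [RHS]mxE.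
  move=> y hd; have U := den_unit b i hd.
  rewrite expr1 /crd /invmx U -scalemxAl [in RHS]mxE mulrA; congr (_ * _).
  by rewrite /den [in RHS](bigD1 (b, i)) //= mulrAC divff ?mul1r // -unitfE -unitmxE.
- exists (n1 + n2)%N, (fun y => den s y ^+ n2 * F1 y + den s y ^+ n1 * F2 y); split.
    by apply: poly_add; apply: poly_mul => //; apply/is_poly_exp/is_poly_den.
  by move=> y hd; rewrite H1 // H2 // exprD; ring.
- exists (n1 + n2)%N, (fun y => F1 y * F2 y); split; first exact: poly_mul.
  by move=> y hd; rewrite H1 // H2 // exprD; ring.
Qed.

Local Notation gclosed := (@gclosed R K d N).

Lemma gclosed_chart s Z : gclosed Z -> zclosed (fun x => Z (sch s x)).
Proof.
move=> [W [[S [pS HS]] ZW]].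
exists (fun q => exists2 p, S p & q = fun x => p (rep_pt s x)); split.
  move=> q [p /pS pp ->]; apply: (is_poly_comp (f := fun u x => rep_pt s x u) pp).
  by move=> [[[b i] a] c]; apply: is_poly_rep.
move=> x; rewrite (ZW _ _ (stiefel_rep_sch s x)) HS.
split=> [h q [p Sp ->]|h p Sp]; first exact: h.
by apply: (h (fun x => p (rep_pt s x))); exists p.
Qed.

(** [Z] is [V] together with the whole complement of the chart: multiplying the equations by [den s]
    makes them hold there. *)
Lemma chart_gclosed s V : zclosed V ->
  exists2 Z, gclosed Z & forall sg, Z sg <-> (forall x, sg = sch s x -> V x).
Proof.
move=> [S [pS HS]]; exists (fun sg => forall x, sg = sch s x -> V x) => //.
have /choice[F HF] f : exists F : (stiefel -> C) -> C, S f -> is_poly F /\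
    forall y, den s y != 0 -> (F y = 0 <-> f (crd s y) = 0).
  case: (pselect (S f)) => [Sf|n]; last by exists (fun=> 0) => /n.
  have [n [F [pF HF]]] := clear_denominators s (pS f Sf).
  exists F => _; split=> // y hd; rewrite HF //.
  split=> [/eqP|->]; last by rewrite mulr0.
  by rewrite mulf_eq0 expf_eq0 (negPf hd) andbF => /eqP.
exists (fun y => forall f, S f -> den s y * F f y = 0); split.
  exists (fun q => exists2 f, S f & q = fun y => den s y * F f y); split.
    move=> q [f Sf ->]; apply: poly_mul; first exact: is_poly_den.
    exact: (HF f Sf).1.
  move=> y; split=> [h q [f Sf ->]|h f Sf]; first exact: h.
  by apply: (h (fun y => den s y * F f y)); exists f.
move=> y sg hy; split=> [h f Sf|h x E].
  case: (eqVneq (den s y) 0) => [->|hd]; first by rewrite mul0r.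
  have [_ HFf] := HF f Sf; apply/eqP; rewrite mulf_eq0 (negPf hd); apply/eqP/HFf => //.
  by move/HS: (h _ (crd_rep hy hd)); apply.
move: hy; rewrite E => /crd_sch[hd <-]; apply/HS => f Sf; apply/((HF f Sf).2 _ hd).
by have /eqP := h f Sf; rewrite mulf_eq0 (negPf hd) => /eqP.
Qed.

(** Makes closures available for [chain_from_chart]. *)
Lemma gclosed_meet (P : (strategy R K d N -> Prop) -> Prop) :
  (forall Z, P Z -> gclosed Z) -> gclosed (fun sg => forall Z, P Z -> Z sg).
Proof.
move=> cP; have /choice[W HW] Z : exists W : (stiefel -> C) -> Prop, P Z ->
    zclosed W /\ forall x s, stiefel_rep x s -> (Z s <-> W x).
  case: (pselect (P Z)) => [PZ|n]; last by exists (fun=> True) => /n.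
  by have [W HW] := cP Z PZ; exists W.
have /choice[S HS] Z : exists S : ((stiefel -> C) -> C) -> Prop, P Z ->
    (forall p, S p -> is_poly p) /\ (forall x, W Z x <-> (forall p, S p -> p x = 0)).
  case: (pselect (P Z)) => [PZ|n]; last by exists (fun=> True) => /n.
  by have [[S H] _] := HW Z PZ; exists S.
exists (fun y => forall Z, P Z -> W Z y); split.
  exists (fun p => exists2 Z, P Z & S Z p); split.
    by move=> p [Z PZ Sp]; apply: (HS Z PZ).1.
  move=> y; split=> [h p [Z PZ Sp]|h Z PZ]; first by move/((HS Z PZ).2 y): (h Z PZ); apply.
  by apply/((HS Z PZ).2 y) => p Sp; apply: h; exists Z.
by move=> y sg hy; split=> h Z PZ; apply/((HW Z PZ).2 _ _ hy); apply: h.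
Qed.

End Charts.

(** * Chains of feasible strategies *)

Section Transfer.
Variable R : realType.
Local Notation C := (R[i]).
Variables K d r : nat.
Local Notation N := (d + r)%N.
Local Notation stiefel := (stiefel_idx K d N).
Local Notation chart_idx := (bool * 'I_K * 'I_d * 'I_r)%type.
Local Notation atlas := {ffun bool * 'I_K -> 'S_(d + r)}.
Local Notation gclosed := (@gclosed R K d N).
Local Notation strat := (strategy R K d N).

Lemma sch_inj s : injective (@sch R K d r s).
Proof.
move=> x x' E; have [_ <-] := crd_sch (stiefel_rep_sch s x).
have hx' : stiefel_rep (rep_pt s x) (sch s x') by rewrite -E; apply: stiefel_rep_sch.
by have [_ <-] := crd_sch hx'.
Qed.

(** A nonempty open part of an irreducible set is irreducible: closed sets of the chart become
    closed sets of strategies once its complement is added. *)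
Lemma chart_irreducible s (c : strat -> Prop) :
  irreducible gclosed c -> (exists x, c (sch s x)) ->
  irreducible (@zclosed R _) (fun x => c (sch s x)).
Proof.
move=> [_ irr] ex; split=> // A B cA cB cAB.
have [ZA gA hA] := chart_gclosed s cA; have [ZB gB hB] := chart_gclosed s cB.
case: (irr ZA ZB gA gB) => [sg csg|h|h].
- case: (pselect (ZA sg)) => [|nA]; [by left | right].
  apply/hB => x E; case: (cAB x); rewrite -?E // => Ax.
  by case: nA; apply/hA => x'; rewrite E => /sch_inj <-.
- by left=> x /h /hA; apply.
- by right=> x /h /hB; apply.
Qed.

(** The chart is taken at a point of the first set, so it meets all of them. Inclusions stay strict:
    otherwise [c k.+1] would be covered by [c k] and the complement of the chart, against
    irreducibility. *)
Lemma chain_to_chart (F : strat -> Prop) m : irr_chain gclosed F m ->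
  exists s (c : nat -> (chart_idx -> C) -> Prop), [/\
   forall k, (k <= m)%N -> zclosed (c k) /\ irreducible (@zclosed R _) (c k),
   forall k, (k < m)%N -> (forall y, c k y -> c k.+1 y) /\ exists y, c k.+1 y /\ ~ c k y &
   forall x, c m x -> F (sch s x)].
Proof.
move=> [c [cP cS]]; have [_ [[sg c0] _] _] := cP 0%N (leq0n _).
have [s [x E]] := sch_surj sg; rewrite {sg}E in c0.
have cx k : (k <= m)%N -> c k (sch s x).
  by elim: k => [//|k IHk] lt; apply: (cS k lt).1; apply/IHk/ltnW.
exists s, (fun k x => c k (sch s x)); split=> [k le|k lt|y].
- have [h1 h2 _] := cP k le; split; first exact: gclosed_chart.
  by apply: chart_irreducible => //; exists x; apply: cx.
- have [sub [sg [csg ncsg]]] := cS k lt; split=> [y|]; first exact: sub.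
  apply: contrapT => /forallNP nc.
  have [Z gZ hZ] : exists2 Z, gclosed Z & forall sg, Z sg <-> forall x, sg = sch s x -> False.
    apply: (chart_gclosed s (V := fun=> False)).
    by apply: (decomp_zclosed (P := fun=> True)); apply: decomp_empty => x' [].
  have [_ [_ irr] _] := cP k.+1 lt; have [gk _ _] := cP k (ltnW lt).
  case: (irr (c k) Z gk gZ) => [sg' csg'|h|h].
  + case: (pselect (exists y, sg' = sch s y)) => [[y Ey]|ne].
      left; apply: contrapT => nck; apply: (nc y); by rewrite -Ey.
    by right; apply/hZ => y Ey; apply: ne; exists y.
  + by apply: ncsg; apply: h.
  + by have /hZ := h _ (cx _ lt); apply.
- by have [_ _ H] := cP m (leqnn m); apply: H.
Qed.

Lemma chain_from_chart s (F : strat -> Prop) m : gclosed F ->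
  irr_chain (@zclosed R _) (fun x => F (sch s x)) m -> irr_chain gclosed F m.
Proof.
move=> gF [c [cP cS]].
(* The closure of the chart set [c k]; by [clE] it meets the chart in [c k] alone. *)
pose cl k sg := forall Z, gclosed Z /\ (forall x, c k x -> Z (sch s x)) -> Z sg.
have clE k x : (k <= m)%N -> (cl k (sch s x) <-> c k x).
  move=> le; split=> [h|ckx Z [_ h]]; last exact: h.
  have [ck _ _] := cP k le; have [Z gZ hZ] := chart_gclosed s ck.
  by have /hZ := h Z (conj gZ (fun x' cx' => (hZ _).2 (fun x'' E => eq_ind x' (c k) cx' x'' (sch_inj E))));
     apply.
exists cl; split=> [k le|k lt].
  have [ck [[x ckx] irr] ckF] := cP k le; split.
  - by apply: gclosed_meet => Z [].
  - split; first by exists (sch s x); apply/clE.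
    move=> A B gA gB clAB.
    case: (irr _ _ (gclosed_chart s gA) (gclosed_chart s gB)) => [y cy|h|h].
    + by apply: clAB; apply/clE.
    + by left=> sg hsg; apply: hsg.
    + by right=> sg hsg; apply: hsg.
  - by move=> sg; apply; split.
have [sub [y [cy ncy]]] := cS k lt; split.
  by move=> sg h Z [gZ hZ]; apply: h; split=> // x /sub; apply: hZ.
exists (sch s y); split; first by apply/clE.
by move/(clE _ _ (ltnW lt)).
Qed.

Lemma feasible_rep (h : H_idx K N -> C) (y : stiefel -> C) (sg : strat) : stiefel_rep y sg ->
  feasible h sg <-> forall p : offdiag K,
    stmat y true (val p).1 *m Hmat h p *m (stmat y false (val p).2)^T = 0.
Proof.
move=> hy; have H b i (u : 'rV[C]_N) : (u <= pt sg b i)%MS = (u <= stmat y b i)%MS.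
  by have /stiefel_repP/(_ b i)/eqmxP E := hy; rewrite -E.
split=> [hf p|hf p u v].
  apply/matrixP => a b; rewrite [RHS]mxE.
  have := hf p (row b (stmat y false (val p).2)) (row a (stmat y true (val p).1)).
  rewrite (H true) (H false) !row_sub => /(_ isT isT) /matrixP/(_ 0 0); rewrite [RHS]mxE => <-.
  by rewrite tr_row -!row_mul !mxE; apply: eq_bigr => i _; rewrite !mxE.
rewrite (H true) (H false) => /submxP[v' ->] /submxP[u' ->].
have -> : v' *m stmat y true (val p).1 *m Hmat h p *m (u' *m stmat y false (val p).2)^T =
  v' *m (stmat y true (val p).1 *m Hmat h p *m (stmat y false (val p).2)^T) *m u'^T.
  by rewrite trmx_mul !mulmxA.
by rewrite hf mulmx0 mul0mx.
Qed.

Lemma gclosed_feasible (h : H_idx K N -> C) : gclosed (feasible h).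
Proof.
pose e (p : offdiag K) (y : stiefel -> C) :=
  stmat y true (val p).1 *m Hmat h p *m (stmat y false (val p).2)^T.
exists (fun y => forall p, e p y = 0); split; last by move=> y sg /feasible_rep.
exists (fun q => exists p a b, q = fun y => e p y a b); split.
  move=> q [p [a [b ->]]]; apply: is_poly_mulmx => [a' c|a' c].
    by apply: is_poly_mulmx => [a'' c'|a'' c']; [exact: is_poly_entry | exact: poly_const].
  apply: (@is_poly_ext R stiefel (fun y => stmat y false (val p).2 c a')) => [y|].
    by rewrite [RHS]mxE.
  exact: is_poly_entry.
move=> y; split=> [hy q [p [a [b ->]]]|hy p]; first by rewrite hy mxE.
by apply/matrixP => a b; rewrite [RHS]mxE; apply: (hy (fun y => e p y a b)); exists p, a, b.
Qed.

(** Permuting rows and columns of the channel matrices turns the chart [s] into that of the identity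
    permutations, so [eqm] serves for all charts. *)
Definition hrel (s : atlas) (h : H_idx K N -> C) : H_idx K N -> C := fun u =>
  let: (p, a, b) := u in h (p, s (true, (val p).1) a, s (false, (val p).2) b).

Lemma Hmat_hrel s h p : Hmat (hrel s h) p =
  perm_mx (s (true, (val p).1)) *m Hmat h p *m (perm_mx (s (false, (val p).2)))^T.
Proof.
rewrite -row_permE tr_perm_mx -col_permE; apply/matrixP => a b; by rewrite !mxE.
Qed.

Lemma hrel_surj s h : exists h', hrel s h' = h.
Proof.
exists (fun u => let: (p, a, b) := u in
  h (p, (s (true, (val p).1))^-1%g a, (s (false, (val p).2))^-1%g b)).
by apply/funext => -[[p a] b]; rewrite /hrel !permK.
Qed.

Definition eqm (h : H_idx K N -> C) (x : chart_idx -> C) (p : offdiag K) : 'M[C]_d :=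
  row_mx 1%:M (xmx x true (val p).1) *m Hmat h p *m (row_mx 1%:M (xmx x false (val p).2))^T.

Lemma feasible_sch s h x : feasible h (sch s x) <-> forall p, eqm (hrel s h) x p = 0.
Proof.
rewrite (feasible_rep h (stiefel_rep_sch s x)).
suff E p : stmat (rep_pt s x) true (val p).1 *m Hmat h p *m (stmat (rep_pt s x) false (val p).2)^T
    = eqm (hrel s h) x p by split=> H p; rewrite ?E // -E.
rewrite !stmat_rep_pt /eqm Hmat_hrel /rep !col_permE !invgK trmx_mul.
by rewrite !mulmxA.
Qed.

Lemma is_poly_row_mx1 b i a c : is_poly (fun x : chart_idx -> C => row_mx 1%:M (xmx x b i) a c).
Proof.
rewrite -[c]splitK; case: (split c) => k.
  by apply: is_poly_ext (poly_const _ ((a == k)%:R)) => x; rewrite row_mxEl mxE.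
by apply: is_poly_ext (poly_var _ (b, i, a, k)) => x; rewrite row_mxEr mxE.
Qed.

Lemma is_poly_eqm (T : Type) (h : (T -> C) -> H_idx K N -> C) (x : (T -> C) -> chart_idx -> C) p a b :
  (forall u, is_poly (fun y => h y u)) -> (forall u, is_poly (fun y => x y u)) ->
  is_poly (fun y => eqm (h y) (x y) p a b).
Proof.
move=> ph px.
have prow b' i' a' c' : is_poly (fun y => row_mx 1%:M (xmx (x y) b' i') a' c').
  exact: (is_poly_comp (f := fun u y => x y u) (is_poly_row_mx1 b' i' a' c')).
apply: is_poly_mulmx => [a' c|a' c].
  apply: is_poly_mulmx => [|a'' c']; first exact: prow.
  by apply: is_poly_ext (ph (p, a'', c')) => y; rewrite mxE.
by apply: is_poly_ext (prow false (val p).2 c a') => y; rewrite [RHS]mxE.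
Qed.

Lemma eqm_block h x p (A : 'M[C]_d) (B : 'M[C]_(d, r)) (A' : 'M[C]_(r, d)) (B' : 'M[C]_r) :
  Hmat h p = block_mx A B A' B' ->
  eqm h x p = A + xmx x true (val p).1 *m A' +
    (B + xmx x true (val p).1 *m B') *m (xmx x false (val p).2)^T.
Proof.
by move=> E; rewrite /eqm E tr_row_mx trmx1 mul_row_block mul_row_col !mul1mx mulmx1.
Qed.

(* The incidence variety {(h, x) | eqm h x = 0} in a chart is the graph, over the entries of h
   outside the upper left blocks and over x, of the function giving these blocks. *)
Definition in_ul (u : H_idx K N) : bool := let: (p, a, b) := u in (a < d)%N && (b < d)%N.

Definition par := ({u : H_idx K N | ~~ in_ul u} + chart_idx)%type.

Definition h0 (y : par -> C) (u : H_idx K N) : C :=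
  if insub u is Some v then y (inl v) else 0.

Definition x0 (y : par -> C) : chart_idx -> C := fun t => y (inr t).

(** An upper left block enters [eqm] as a summand, so subtracting the residue left by [h0], where
    these blocks are zero, solves the equations. *)
Definition hy (y : par -> C) (u : H_idx K N) : C :=
  let: (p, a, b) := u in (Hmat (h0 y) p - block_mx (eqm (h0 y) (x0 y) p) 0 0 0) a b.

Lemma h0_ul (y : par -> C) p (a b : 'I_d) : h0 y (p, lshift r a, lshift r b) = 0.
Proof. by rewrite /h0 insubN // /= !ltn_ord. Qed.

Lemma h0_out (y : par -> C) u (nu : ~~ in_ul u) : h0 y u = y (inl (Sub u nu)).
Proof. by rewrite /h0 insubT. Qed.

Lemma Hmat_hy y p : Hmat (hy y) p = Hmat (h0 y) p - block_mx (eqm (h0 y) (x0 y) p) 0 0 0.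
Proof. by apply/matrixP => a b; rewrite mxE. Qed.

Lemma eqm_hy y p : eqm (hy y) (x0 y) p = 0.
Proof.
rewrite {1}/eqm Hmat_hy mulmxBr mulmxBl -/(eqm _ _ _) tr_row_mx trmx1.
rewrite mul_row_block mul_row_col !mulmx0 !mul1mx mulmx1 !addr0 mul0mx addr0.
exact: subrr.
Qed.

Lemma hy_surj h x : (forall p, eqm h x p = 0) -> exists y, hy y = h /\ x0 y = x.
Proof.
move=> H; pose y (v : par) : C := match v with inl u => h (val u) | inr t => x t end.
exists y; split=> //; apply/funext => -[[p a] b].
have E : Hmat (h0 y) p = Hmat h p - block_mx (ulsubmx (Hmat h p)) 0 0 0.
  apply/matrixP => a' b'; rewrite [LHS]mxE [RHS]mxE [_ a' b' in X in X + _]mxE [X in _ + X]mxE.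
  rewrite -[a']splitK -[b']splitK.
  case: (split a') => a1; case: (split b') => b1 /=.
  - by rewrite h0_ul block_mxEul !mxE subrr.
  - have nu : ~~ in_ul (p, lshift r a1, rshift d b1) by rewrite /= ltn_ord /= -leqNgt leq_addr.
    by rewrite (h0_out _ nu) block_mxEur !mxE subr0.
  - have nu : ~~ in_ul (p, rshift d a1, lshift r b1) by rewrite /= ltnNge leq_addr.
    by rewrite (h0_out _ nu) block_mxEdl !mxE subr0.
  - have nu : ~~ in_ul (p, rshift d a1, rshift d b1) by rewrite /= ltnNge leq_addr.
    by rewrite (h0_out _ nu) block_mxEdr !mxE subr0.
have E2 : eqm (h0 y) x p = - ulsubmx (Hmat h p).
  rewrite {1}/eqm E mulmxBr mulmxBl -/(eqm _ _ _) H tr_row_mx trmx1.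
  rewrite mul_row_block mul_row_col !mulmx0 !mul1mx mulmx1 !addr0 mul0mx addr0.
  exact: sub0r.
rewrite /hy E (_ : x0 y = x) // E2 -addrA -opprD add_block_mx subrr !addr0.
by rewrite (_ : block_mx 0 0 0 0 = 0) ?subr0 ?mxE // block_mx0.
Qed.

Lemma is_poly_h0 u : is_poly (fun y => h0 y u).
Proof. by rewrite /h0; case: insub => [v|]; [exact: poly_var | exact: poly_const]. Qed.

Lemma is_poly_x0 t : is_poly (fun y => x0 y t).
Proof. exact: poly_var. Qed.

Lemma is_poly_hy u : is_poly (fun y => hy y u).
Proof.
case: u => [[p a] b].
apply: (@is_poly_ext _ _ (fun y => h0 y (p, a, b) - block_mx (eqm (h0 y) (x0 y) p) 0 0 0 a b)).
  by move=> y; rewrite /hy !mxE.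
apply: is_poly_sub; first exact: is_poly_h0.
rewrite -[a]splitK -[b]splitK; case: (split a) => a1; case: (split b) => b1 /=.
- apply: (@is_poly_ext _ _ (fun y => eqm (h0 y) (x0 y) p a1 b1)) => [y|].
    by rewrite block_mxEul.
  by apply: is_poly_eqm; [exact: is_poly_h0 | exact: is_poly_x0].
- by apply: is_poly_ext (poly_const _ 0) => y; rewrite block_mxEur mxE.
- by apply: is_poly_ext (poly_const _ 0) => y; rewrite block_mxEdl mxE.
- by apply: is_poly_ext (poly_const _ 0) => y; rewrite block_mxEdr mxE.
Qed.

(** The entries of [h] and the [k] coordinates are too many functions on the affine space [par], so
    they satisfy a relation [G]. Freezing the coordinates at a point [w] where [G] is nonzero gives
    [g]; where [g h] is nonzero, [G] at [h] is a nonzero relation between the coordinates alone. *)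
Lemma fibre_dep k (j : 'I_k -> chart_idx) : (#|{: par}| < #|{: H_idx K N}| + k)%N ->
  exists g : (H_idx K N -> C) -> C, [/\ is_poly g, exists h, g h != 0 &
    forall h, g h != 0 -> dep (fun x => forall p, eqm h x p = 0) (fun i x => x (j i))].
Proof.
move=> lt.
pose f (q : H_idx K N + 'I_k) (y : par -> C) : C :=
  match q with inl u => hy y u | inr i => x0 y (j i) end.
(* No injection from [#|{: par}|.+1] indices exists, so the dependence hypothesis of [dep_growth] is
   vacuous. *)
have [|j' /leq_card|[u|i]|G [pG [w Gw] HG]] :=
    @dep_growth R (par : finType) (H_idx K N + 'I_k)%type (fun=> True) f #|{: par}|.+1.
- by rewrite [X in (_ <= X)%N]card_sum card_ord.
- by rewrite card_ord ltnn.
- exact: is_poly_hy.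
- exact: is_poly_x0.
pose gl (h : H_idx K N -> C) (z : 'I_k -> C) := G (join_pt h z).
exists (fun h => gl h (fun i => w (inr i))); split.
- apply: (is_poly_comp (f := fun q h => join_pt h (fun i => w (inr i)) q) pG) => -[u|i] /=.
    exact: poly_var.
  exact: poly_const.
- exists (fun u => w (inl u)); rewrite /gl (_ : join_pt _ _ = w) //.
  by apply/funext => -[].
move=> h gh; exists (gl h); split.
- apply: (is_poly_comp (f := fun q z => join_pt h z q) pG) => -[u|i] /=.
    exact: poly_const.
  exact: poly_var.
- by exists (fun i => w (inr i)).
by move=> x /hy_surj[y [<- <-]]; rewrite -[RHS](HG y I).
Qed.

(** There are finitely many charts and choices of coordinates, so the product of their conditions is
    still nonzero. *)
Lemma generic_upper k : (#|{: par}| < #|{: H_idx K N}| + k)%N ->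
  exists g : (H_idx K N -> C) -> C, [/\ is_poly g, exists h, g h != 0 &
    forall h, g h != 0 -> forall s (j : 'I_k -> chart_idx),
      dep (fun x => feasible h (sch s x)) (fun i x => x (j i))].
Proof.
move=> lt.
have /choice[g Hg] (j : {ffun 'I_k -> chart_idx}) := fibre_dep j lt.
pose gs (v : atlas * {ffun 'I_k -> chart_idx}) h := g v.2 (hrel v.1 h).
have pgs v : is_poly (gs v).
  have [pg _ _] := Hg v.2.
  apply: (is_poly_comp (f := fun u h => hrel v.1 h u) pg) => -[[p a] b]; exact: poly_var.
exists (fun h => \prod_v gs v h); split.
- by apply: is_poly_prod.
- apply: is_poly_prod_neq0 => // v; have [_ [h gh] _] := Hg v.2.
  by have [h' E] := hrel_surj v.1 h; exists h'; rewrite /gs E.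
move=> h gh s j.
have gsj : gs (s, finfun j) h != 0.
  by apply: contraNneq gh => E; rewrite (bigD1 (s, finfun j)) //= E mul0r.
have [_ _ /(_ _ gsj)] := Hg (finfun j); case=> G [pG nG HG].
exists G; split=> // x /feasible_sch /HG; rewrite (_ : (fun i => _) = fun i => x (j i)) //.
by apply/funext => i; rewrite ffunE.
Qed.

Lemma upper_bound k h :
  (forall s (j : 'I_k -> chart_idx),
      dep (fun x => feasible h (sch s x)) (fun i x => x (j i))) ->
  ~ irr_chain gclosed (feasible h) k.
Proof.
move=> H /chain_to_chart[s [c [cP cS cF]]].
by apply: (dep_no_chain cP cS cF) => j _; apply: H.
Qed.

Lemma upper_empty h :
  (forall s (j : 'I_0 -> chart_idx),
      dep (fun x => feasible h (sch s x)) (fun i x => x (j i))) ->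
  forall sg : strat, ~ feasible h sg.
Proof.
move=> H sg; have [s [x ->]] := sch_surj sg => hx.
pose j (i : 'I_0) : chart_idx := False_rect _ (notF (ltn_ord i)).
have [G [pG [z Gz] HG]] := H s j.
by move/eqP: Gz; apply; rewrite -[RHS](HG x hx); congr G; apply/funext => -[].
Qed.

End Transfer.

(** * Completing independent linear forms *)

Section LinearForms.
Variable F : fieldType.

Definition lin_form (T : Type) (f : (T -> F) -> F) : Prop :=
  forall a u v, f (fun t => a * u t + v t) = a * f u + f v.

Lemma lin_form_expand (T : finType) (f : (T -> F) -> F) x :
  lin_form f -> f x = \sum_t f (fun s => (s == t)%:R) * x t.
Proof.
move=> lf; have H (l : seq T) : f (fun s => \sum_(t <- l) x t * (s == t)%:R) =
    \sum_(t <- l) f (fun s => (s == t)%:R) * x t.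
  elim: l => [|t l IHl].
    rewrite big_nil; set z := fun s => _; have := lf (-1) z z.
    rewrite (_ : (fun t => -1 * z t + z t) = z); last by apply/funext => s; rewrite /z big_nil mulr0 addr0.
    by move=> ->; rewrite mulN1r addNr.
  rewrite (_ : (fun s => _) = fun s => x t * (s == t)%:R + \sum_(t <- l) x t * (s == t)%:R).
    by rewrite lf IHl big_cons mulrC.
  by apply/funext => s; rewrite big_cons.
rewrite -H; congr f; apply/funext => s.
rewrite (bigD1 s) //= eqxx mulr1 big1 ?addr0 // => t.
by rewrite eq_sym => /negPf ->; rewrite mulr0.
Qed.

Lemma complete_linear_forms (T E : finType) n (L : E -> (T -> F) -> F) :
  (forall e, lin_form (L e)) -> #|T| = (#|E| + n)%N ->
  (forall w : E -> F, exists x, forall e, L e x = w e) ->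
  exists l : 'I_n -> T -> F, forall (w : E -> F) (a : 'I_n -> F),
    exists x, (forall e, L e x = w e) /\ forall i, \sum_t l i t * x t = a i.
Proof.
move=> lL cT surj.
pose idx t : 'I_(#|E| + n) := cast_ord cT (enum_rank t).
pose unidx k : T := enum_val (cast_ord (esym cT) k).
have idxK : cancel idx unidx by move=> t; rewrite /unidx /idx cast_ordK enum_rankK.
have unidxK : cancel unidx idx by move=> t; rewrite /unidx /idx enum_valK cast_ordKV.
have sumE (G : T -> F) : \sum_t G t = \sum_(k < #|E| + n) G (unidx k).
  by rewrite (reindex unidx) //; apply: onW_bij; exists idx.
pose M : 'M[F]_(#|E|, #|E| + n) :=
  \matrix_(e, k) L (enum_val e) (fun s => (s == unidx k)%:R).
have ME e (v : 'cV_(#|E| + n)) : L e (fun t => v (idx t) 0) = (M *m v) (enum_rank e) 0.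
  rewrite (lin_form_expand _ (lL e)) mxE sumE; apply: eq_bigr => k _.
  by rewrite mxE enum_rankK unidxK.
have [|l Hl] := @complete_surjection F #|E| n M.
  move=> w; have [x Hx] := surj (fun e => w (enum_rank e) 0).
  exists (\col_k x (unidx k)); apply/colP => j.
  rewrite -[j]enum_valK -ME -[RHS](Hx (enum_val j)); congr (L _ _).
  by apply/funext => t; rewrite mxE idxK.
exists (fun i t => l i (idx t)) => w a.
have [v [Hv1 Hv2]] := Hl (\col_i w (enum_val i)) (\col_i a i).
exists (fun t => v (idx t) 0); split=> [e|i]; first by rewrite ME Hv1 mxE enum_rankK.
have /colP/(_ i) := Hv2; rewrite !mxE => <-; rewrite sumE; apply: eq_bigr => k _.
by rewrite unidxK.
Qed.

End LinearForms.

Lemma card_offdiag K : #|{: offdiag K}| = (K * K.-1)%N.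
Proof.
rewrite card_sig; have := cardC [pred p : 'I_K * 'I_K | p.1 == p.2].
rewrite card_prod !card_ord.
have -> : #|[pred p : 'I_K * 'I_K | p.1 == p.2]| = K.
  rewrite -[RHS]card_ord -[RHS]cardsT -(@card_imset _ _ (fun i : 'I_K => (i, i))); last by move=> i j [].
  apply: eq_card => -[i j]; rewrite !inE /=; apply/eqP/imsetP => [->|[k _ [-> ->]] //].
  by exists j.
rewrite (_ : #|[predC _]| = #|[pred x : 'I_K * 'I_K | x.1 != x.2]|); last exact: eq_card.
by case: K => [|K]; rewrite /= ?mulnS; lia.
Qed.

(** * Dominance of the incidence variety and the lower bound *)

Section Generic.
Variable R : realType.
Local Notation C := (R[i]).
Variables K d r : nat.
Local Notation N := (d + r)%N.
Local Notation chart_idx := (bool * 'I_K * 'I_d * 'I_r)%type.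
Local Notation eqs := (offdiag K * 'I_d * 'I_d)%type.

Lemma card_in_ul : #|[pred u | @in_ul K d r u]| = #|{: eqs}|.
Proof.
pose f (e : eqs) : H_idx K N := let: (p, a, b) := e in (p, lshift r a, lshift r b).
have finj : injective f.
  by move=> [[p a] b] [[p' a'] b'] [-> /val_inj -> /val_inj ->].
rewrite -cardsT -(card_imset _ finj); apply: eq_card => -[[p a] b]; rewrite !inE /=.
apply/andP/imsetP => [[ha hb]|[[[p' a'] b'] _ [_ -> ->]]]; last by rewrite /= !ltn_ord.
exists (p, Ordinal ha, Ordinal hb); rewrite ?inE //=.
by congr (_, _, _); apply: val_inj.
Qed.

Lemma card_par : (#|{: @par K d r}| + #|{: eqs}| = #|{: H_idx K N}| + #|{: chart_idx}|)%N.
Proof.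
rewrite card_sum card_sig -card_in_ul -(cardC [pred u | @in_ul K d r u]).
by rewrite addnAC [(#|_| + #|[pred u | in_ul u]|)%N]addnC.
Qed.

Lemma xmx_lin a (u v : chart_idx -> C) b i :
  xmx (fun t => a * u t + v t) b i = a *: xmx u b i + xmx v b i.
Proof. by apply/matrixP => k l; rewrite !mxE. Qed.

Lemma generic_lower n : (3 <= K)%N -> (K.-1 * d <= r.*2)%N ->
  #|{: chart_idx}| = (#|{: eqs}| + n)%N ->
  exists g : (H_idx K N -> C) -> C, [/\ is_poly g, exists h, g h != 0 &
    forall h, g h != 0 -> irr_chain (@zclosed R _) (fun x => forall p, eqm h x p = 0) n].
Proof.
move=> K3 hr cE; have [A [B HAB]] := blocks_surjective C K3 hr.
(* For channel matrices with blocks [0], [B], [A], [0] this is [eqm] itself. *)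
pose L (e : eqs) (x : chart_idx -> C) : C := let: (p, a, b) := e in
  (xmx x true (val p).1 *m A (val p).1 (val p).2 +
   B (val p).1 (val p).2 *m (xmx x false (val p).2)^T) a b.
have [[[p a] b] c u v|w|l Hl] := @complete_linear_forms C (chart_idx : finType) (eqs : finType) n L _ cE.
- rewrite /L !xmx_lin mulmxDl linearD mulmxDr linearZ /= -scalemxAl -scalemxAr.
  by rewrite !mxE; ring.
- have [Y [X HYX]] := HAB (fun i j => \matrix_(a, b)
    if insub (i, j) is Some p then w (p, a, b) else 0).
  exists (fun t => let: (b, i, a, c) := t in if b then Y i a c else X i c a).
  move=> [[p a] b]; rewrite /L.
  rewrite (_ : xmx _ true _ = Y (val p).1); last by apply/matrixP => a' c'; rewrite mxE.
  rewrite (_ : (xmx _ false _)^T = X (val p).2); last by apply/matrixP => a' c'; rewrite !mxE.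
  rewrite HYX ?(valP p) // mxE (_ : (_, _) = val p); last by case: (val p).
  by rewrite valK.
pose ell i (x : chart_idx -> C) := \sum_t l i t * x t.
have pell i : is_poly (ell i).
  by apply: is_poly_sum => t _; apply: poly_mul; [exact: poly_const | exact: poly_var].
(* A common zero over [(h, a)] is a point of the incidence variety above [h] at which the forms
   [ell] take the values [a]. *)
pose F (e : eqs + 'I_n) (z : (H_idx K N + 'I_n) + chart_idx -> C) : C :=
  match e with
  | inl (p, a, b) => eqm (fun u => z (inl (inl u))) (fun t => z (inr t)) p a b
  | inr i => ell i (fun t => z (inr t)) - z (inl (inr i))
  end.
have pF e : is_poly (F e).
  case: e => [[[p a] b]|i]; first by apply: is_poly_eqm => u; apply: poly_var.
  apply: is_poly_sub; last exact: poly_var.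
  by apply: (is_poly_comp (f := fun t z => z (inr t)) (pell i)) => t; apply: poly_var.
have [g [pg [w0 gw0] Hg]] := image_dichotomy pF.
have {}Hg : forall z, g z != 0 -> exists x, forall e, F e (join_pt z x) = 0.
  (* If the image missed the set [g != 0], then [g] would vanish along curves of the image in every
     direction [w], hence everywhere. *)
  case: Hg => // Hg; exfalso; move/eqP: gw0; apply.
  pose Hb (p : offdiag K) : 'M[C]_N := block_mx 0 (B (val p).1 (val p).2) (A (val p).1 (val p).2) 0.
  pose pb (q : H_idx K N + 'I_n) : C := match q with
    | inl (p, a, b) => Hb p a b | inr i => 0 end.
  apply: (vanish_along_curves (p := pb) pg) => w.
  (* To first order the upper left blocks of [hy] move by minus the linearized equations, so [x1] is
     chosen to make this the direction prescribed by [w]. *)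
  have [x1 [x1L x1l]] := Hl (fun e => let: (p, a, b) := e in - w (inl (p, lshift r a, lshift r b)))
    (fun i => w (inr i)).
  pose W (p : offdiag K) : 'M[C]_N := \matrix_(a, b) w (inl (p, a, b)).
  pose Y1 (p : offdiag K) := xmx x1 true (val p).1; pose X1 (p : offdiag K) := (xmx x1 false (val p).2)^T.
  (* Along the curve [eqm] is cubic in [t]; its coefficients [c2] and [c3] are absorbed by the
     higher-order term that [vanish_along_curves] allows. *)
  pose c2 (p : offdiag K) := Y1 p *m dlsubmx (W p) + ursubmx (W p) *m X1 p.
  pose c3 (p : offdiag K) := Y1 p *m drsubmx (W p) *m X1 p.
  pose Q2 (p : offdiag K) : 'M[C]_N := block_mx (- c2 p) 0 0 0.
  pose Q3 (p : offdiag K) : 'M[C]_N := block_mx (- c3 p) 0 0 0.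
  exists (fun q => match q with
    | inl (p, a, b) => (Q2 p a b)%:P + (Q3 p a b)%:P * 'X | inr i => 0 end) => t.
  pose y (v : @par K d r) : C := match v with
    | inl u => pb (inl (val u)) + t * w (inl (val u)) | inr s => t * x1 s end.
  have xy b i : xmx (x0 y) b i = t *: xmx x1 b i by apply/matrixP => a' c'; rewrite !mxE.
  have H0 p : Hmat (h0 y) p = block_mx 0 (B (val p).1 (val p).2 + t *: ursubmx (W p))
     (A (val p).1 (val p).2 + t *: dlsubmx (W p)) (t *: drsubmx (W p)).
    apply/matrixP => a' b'; rewrite [LHS]mxE -[a']splitK -[b']splitK.
    case: (split a') => a1; case: (split b') => b1 /=.
    - by rewrite h0_ul block_mxEul mxE.
    - have nu : ~~ in_ul (p, lshift r a1, rshift d b1) by rewrite /= ltn_ord /= -leqNgt leq_addr.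
      by rewrite (h0_out _ nu) /= block_mxEur /Hb block_mxEur !mxE.
    - have nu : ~~ in_ul (p, rshift d a1, lshift r b1) by rewrite /= ltnNge leq_addr.
      by rewrite (h0_out _ nu) /= block_mxEdl /Hb block_mxEdl !mxE.
    - have nu : ~~ in_ul (p, rshift d a1, rshift d b1) by rewrite /= ltnNge leq_addr.
      by rewrite (h0_out _ nu) /= block_mxEdr /Hb block_mxEdr !mxE add0r.
  have HL p : Y1 p *m A (val p).1 (val p).2 + B (val p).1 (val p).2 *m X1 p = - ulsubmx (W p).
    by apply/matrixP => a' b'; have := x1L (p, a', b'); rewrite /L => ->; rewrite !mxE.
  have Eq p : eqm (h0 y) (x0 y) p = - (t *: ulsubmx (W p)) + (t ^+ 2 *: c2 p + t ^+ 3 *: c3 p).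
    rewrite (eqm_block _ (H0 p)) !xy -scalerN -HL /c2 /c3 linearZ /= -/(Y1 p) -/(X1 p).
    have -> : (t *: xmx x1 false (val p).2)^T = t *: X1 p by rewrite linearZ.
    rewrite add0r !(mulmxDr, mulmxDl) -!(scalemxAl, scalemxAr) !scalerDr !scalerA.
    rewrite [t ^+ 3]exprS expr2.
    by rewrite -!addrA; congr (_ + _); rewrite [LHS]addrCA.
  have HyE p : Hmat (hy y) p = Hb p + t *: (W p + t *: (Q2 p + t *: Q3 p)).
    rewrite Hmat_hy H0 Eq /Hb /Q2 /Q3 [in RHS](_ : W p = block_mx (ulsubmx (W p))
      (ursubmx (W p)) (dlsubmx (W p)) (drsubmx (W p))); last by rewrite submxK.
    move: (c2 p) (c3 p) (ulsubmx (W p)) (ursubmx (W p)) (dlsubmx (W p)) (drsubmx (W p)).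
    move: (B _ _) (A _ _) => MB MA m2 m3 w1 w2 w3 w4.
    rewrite !scale_block_mx !add_block_mx !scale_block_mx !add_block_mx.
    rewrite !scale_block_mx opp_block_mx !add_block_mx !scaler0 !addr0 !oppr0 !addr0 !add0r.
    congr (block_mx _ _ _ _); apply/matrixP => a b; rewrite !mxE; ring.
  apply/eqP; apply: contrapT => /negP gn; apply: (Hg _ gn); exists (x0 y).
  rewrite (_ : (fun i => _) = join_pt (hy y) (fun i => ell i (x0 y))).
    move=> [[[p a] b]|i] /=; last by rewrite subrr.
    by rewrite (eqm_hy y p) mxE.
  apply/funext => -[[[p a] b]|i] /=.
    have /matrixP/(_ a b) := HyE p; rewrite [LHS]mxE => E; apply: etrans (esym E).
    have <- : W p a b = w (inl (p, a, b)) by rewrite mxE.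
    move: (Hb p) (W p) (Q2 p) (Q3 p) => M1 M2 M3 M4.
    by rewrite !mxE !hornerE [_ * t]mulrC.
  rewrite horner0 mulr0 addr0 add0r -x1l mulr_sumr; apply: eq_bigr => s _.
  by rewrite mulrCA.
exists (fun h => g (join_pt h (fun i => w0 (inr i)))); split.
- apply: (is_poly_comp (f := fun q h => join_pt h (fun i => w0 (inr i)) q) pg) => -[u|i] /=.
    exact: poly_var.
  exact: poly_const.
- exists (fun u => w0 (inl u)); rewrite (_ : join_pt _ _ = w0) //.
  by apply/funext => -[].
move=> h gh; apply: (@chain_exists R _ n _ ell (fun a => g (join_pt h a))).
- exists (fun q => exists p a b, q = fun x => eqm h x p a b); split.
    move=> q [p [a [b ->]]]; apply: (is_poly_eqm (h := fun _ => h) (x := fun x => x)) => u.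
      exact: poly_const.
    exact: poly_var.
  move=> x; split=> [hx q [p [a [b ->]]]|hx p]; first by rewrite hx mxE.
  by apply/matrixP => a b; rewrite [RHS]mxE; apply: (hx (fun x => eqm h x p a b)); exists p, a, b.
- exact: pell.
- apply: (is_poly_comp (f := fun q a => join_pt h a q) pg) => -[u|i] /=.
    exact: poly_const.
  exact: poly_var.
- by exists (fun i => w0 (inr i)).
move=> a /Hg[x Hx]; exists x => [p|i].
  by apply/matrixP => a' b'; rewrite [RHS]mxE; apply: (Hx (inl (p, a', b'))).
by apply/eqP; rewrite -subr_eq0; apply/eqP; apply: (Hx (inr i)).
Qed.

End Generic.

Lemma generic_nonzero (R : realType) (T : finType) (g : (T -> R[i]) -> R[i])
    (P : (T -> R[i]) -> Prop) :
  is_poly g -> (exists x, g x != 0) -> (forall x, g x != 0 -> P x) -> generic P.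
Proof.
move=> pg ng gP; exists (fun x => g x != 0); split=> //.
by apply: zclosed_iff (zclosed_zero pg) => x; split=> [->|/negP]; rewrite ?eqxx // negbK => /eqP.
Qed.

Theorem theorem3 (R : realType) (K N d : nat)
    (hK : (3 <= K)%N) (hN : (1 <= N)%N) (hd : (1 <= d)%N) :
  generic (fun h : H_idx K N -> R[i] =>
    (0 <= K%:Z * d%:Z * (2 * N%:Z - (K%:Z + 1) * d%:Z) ->
       (exists s : strategy R K d N, feasible h s) /\
       has_dim (@gclosed R K d N) (feasible h)
         (absz (K%:Z * d%:Z * (2 * N%:Z - (K%:Z + 1) * d%:Z)))) /\
    (K%:Z * d%:Z * (2 * N%:Z - (K%:Z + 1) * d%:Z) < 0 ->
       forall s : strategy R K d N, ~ feasible h s)).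
Proof.
have Kd0 : 0 < K%:Z * d%:Z :> int by rewrite mulr_gt0 ?ltz_nat // (leq_trans _ hK).
(* For [N < d] there is no [d]-dimensional subspace, and the expected dimension is negative. *)
case: (leqP d N) => [dN|Nd]; last first.
  have lt0 : 2 * N%:Z - (K%:Z + 1) * d%:Z < 0 :> int by nia.
  apply: (@generic_nonzero _ _ (fun=> 1)); first exact: poly_const.
    by exists (fun=> 0); rewrite oner_eq0.
  move=> h _; split=> [|_ s _]; first by rewrite pmulr_rge0 // leNgt lt0.
  have i : 'I_K by exists 0%N; apply: leq_trans hK.
  have /andP[_ /eqP rk] := valP (s.1 i).
  by have := rank_leq_row (val (s.1 i)); rewrite rk leqNgt Nd.
have [r Nr] : exists r, N = (d + r)%N by exists (N - d)%N; rewrite subnKC.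
move: hN dN; rewrite {}Nr => _ _ {N}.
set D := _ * _ * _ : int.
have cE : #|{: offdiag K * 'I_d * 'I_d}| = (K * K.-1 * d * d)%N.
  by rewrite !card_prod card_offdiag !card_ord.
have cT : #|{: bool * 'I_K * 'I_d * 'I_r}| = (2 * K * d * r)%N.
  by rewrite !card_prod card_bool !card_ord.
(* The expected dimension is the number of chart coordinates minus the number of equations. *)
have DE : D = (2 * K * d * r)%N%:Z - (K * K.-1 * d * d)%N%:Z.
  by rewrite /D; case: (K) hK => // k _; rewrite /= !PoszD !PoszM; ring.
have cP := card_par K d r; rewrite cE cT in cP.
case: (leP 0 D) => D0; last first.
  have lt : (#|{: par K d r}| < #|{: H_idx K (d + r)}| + 0)%N by lia.
  have [g [pg ng Hg]] := generic_upper R lt.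
  apply: (generic_nonzero pg ng) => h gh; split=> [//|_].
  by apply: upper_empty => s j; apply: Hg.
have [n Dn] : exists n : nat, D = n by exists `|D|%N; rewrite gez0_abs.
have lt : (#|{: par K d r}| < #|{: H_idx K (d + r)}| + n.+1)%N by lia.
have [g1 [pg1 ng1 Hg1]] := generic_upper R lt.
(* This is [0 <= D] divided by [K * d]. *)
have hr : (K.-1 * d <= r.*2)%N.
  move: D0; rewrite /D pmulr_rge0 //; case: (K) hK => // k _ /=; nia.
have [|g2 [pg2 ng2 Hg2]] := @generic_lower R K d r n hK hr.
  by rewrite cE cT; lia.
pose s1 : {ffun bool * 'I_K -> 'S_(d + r)} := [ffun=> 1%g].
have hrel1 h : @hrel R K d r s1 h = h.
  by apply/funext => -[[p a] b]; rewrite /hrel !ffunE !perm1.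
apply: (@generic_nonzero _ _ (fun h => g1 h * g2 h)); first exact: poly_mul.
  exact: is_poly_mul_neq0.
move=> h; rewrite mulf_eq0 negb_or => /andP[/Hg1 up /Hg2 low].
split=> [_|//].
have chain : irr_chain (@gclosed R K d (d + r)) (feasible h) n.
  apply: (chain_from_chart (s := s1)); first exact: gclosed_feasible.
  have -> // : (fun x => feasible h (sch s1 x)) = (fun x => forall p, eqm h x p = 0).
  by apply/funext => x; apply/propext; rewrite feasible_sch hrel1.
split.
  have [c [cP' _]] := chain; have [_ [[s c0] _] cF] := cP' 0%N (leq0n _).
  by exists s; apply: cF.
by rewrite Dn absz_nat; split=> //; apply: upper_bound => s j; apply: up.
Qed.
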